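(* For $\lambda\in\Lambda^+$, the global Weyl module $W(\lambda)$ is generated (as a $\mathfrak{g}\otimes A$-module) by $w_\lambda$, with defining relations $$(\mathfrak{n}^+\otimes A)w_\lambda=0,\qquad h w_\lambda=\lambda(h)w_\lambda,\qquad Y_\alpha^{\lambda(H_\alpha)+1}w_\lambda=0,\qquad \text{for all } h\in\mathfrak{h},\ \alpha\in\Sigma(\mathfrak{g}_{\bar 0}).$$
   Context: Everything is over $\mathbb{C}$, and $\mathbb{N}=\{0,1,2,\dots\}$. $\mathfrak{g}=\mathfrak{g}_{\bar 0}\oplus\mathfrak{g}_{\bar 1}$ is either a basic classical Lie superalgebra (finite-dimensional, simple, $\mathfrak{g}_{\bar 1}$ completely reducible over $\mathfrak{g}_{\bar 0}$, with a nondegenerate invariant bilinear form; simple Lie algebras are allowed) or $\mathfrak{sl}(n,n)$, $n\ge 2$. $A$ is an associative commutative unital $\mathbb{C}$-algebra. Simple roots. Suppose first that $\mathfrak{g}$ is basic and not of the form $A(n-1,n-1)=\mathfrak{sl}(n,n)/\mathbb{C}\,\mathrm{id}$, or that $\mathfrak{g}=\mathfrak{gl}(n,n)$; let $\mathfrak{h}$ be a Cartan subalgebra (of $\mathfrak g_{\bar 0}$) and $\Delta$ the set of roots; each root is even or odd. A linearly independent subset $\Sigma\subseteq\Delta$ is a system of simple roots if there are $X_\beta\in\mathfrak{g}_\beta$, $Y_\beta\in\mathfrak{g}_{-\beta}$ ($\beta\in\Sigma$) which together with $\mathfrak{h}$ generate $\mathfrak{g}$ and satisfy $[X_\beta,Y_{\beta'}]=0$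 for $\beta\ne\beta'$; put $H_\beta=[X_\beta,Y_\beta]$. Every root is then a nonnegative (positive root) or nonpositive (negative root) integer combination of $\Sigma$. $\mathfrak{n}^+$ (resp. $\mathfrak{n}^-$) is the subalgebra generated by the $X_\beta$ (resp. $Y_\beta$), and $\mathfrak{g}=\mathfrak{n}^-\oplus\mathfrak{h}\oplus\mathfrak{n}^+$. For $\mathfrak{g}=\mathfrak{sl}(n,n)$ or $A(n-1,n-1)$, $\Sigma$ is a system of simple roots of $\mathfrak{gl}(n,n)$, the triangular decomposition $\mathfrak{g}=\mathfrak{n}^-\oplus\mathfrak{h}\oplus\mathfrak{n}^+$ and the division into positive and negative roots are those induced from $\mathfrak{gl}(n,n)$, and $\mathfrak{h}$ denotes the span of the $H_\beta$, $\beta\in\Sigma$ (modulo the one-dimensional center in the case $A(n-1,n-1)$). Fix $\Sigma$. $\Delta^+_{\bar 0}$ denotes the set of even positive roots; $\Sigma(\mathfrak{g}_{\bar 0})$ is the set of simple roots of the reductive Lie algebra $\mathfrak{g}_{\bar 0}$ for the positive system $\Delta^+_{\bar 0}$. For each $\alpha\in\Delta^+_{\bar 0}$ fix an $\mathfrak{sl}(2)$-triple $X_\alpha\in\mathfrak{g}_\alpha$, $Y_\alpha\in\mathfrak{g}_{-\alpha}$, $H_\alpha\in\mathfrak{h}$. $V(\lambda)$ is the irreducible highest weight $\mathfrak{g}$-module of highest weight $\lambda\in\mathfrak{h}^*$ with respect to $\mathfrak{h}\oplus\mathfrak{n}^+$, and $\Lambda^+=\{\lambda\in\mathfrak{h}^*\mid\dim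 V(\lambda)<\infty\}$. For $\lambda\in\Lambda^+$ one has $\lambda(H_\alpha)\in\mathbb{N}$ for all $\alpha\in\Sigma(\mathfrak{g}_{\bar 0})$, and $\bar V(\lambda)$ is the $\mathfrak{g}$-module generated by $v_\lambda$ with defining relations $\mathfrak{n}^+v_\lambda=0$, $hv_\lambda=\lambda(h)v_\lambda$, $Y_\alpha^{\lambda(H_\alpha)+1}v_\lambda=0$ ($h\in\mathfrak{h}$, $\alpha\in\Sigma(\mathfrak{g}_{\bar 0})$). $\mathfrak{g}\otimes A$ has bracket $[x_1\otimes a_1,x_2\otimes a_2]=[x_1,x_2]\otimes a_1a_2$ and grading $(\mathfrak{g}\otimes A)_j=\mathfrak{g}_j\otimes A$; $\mathfrak{g}$ is identified with $\mathfrak{g}\otimes 1$. $\mathcal{I}(\mathfrak{g}\otimes A,\mathfrak{g}_{\bar 0})$ is the full subcategory of $\mathfrak{g}\otimes A$-modules whose restriction to $\mathfrak{g}_{\bar 0}$ is isomorphic to a direct sum of irreducible finite-dimensional $\mathfrak{g}_{\bar 0}$-modules. For a $\mathfrak{g}$-module $V$, $P_A(V)=U(\mathfrak{g}\otimes A)\otimes_{U(\mathfrak{g})}V$, with $V$ identified with $1\otimes V$; for $\lambda\in\Lambda^+$, $P_A(\bar V(\lambda))$ is an object of $\mathcal{I}(\mathfrak{g}\otimes A,\mathfrak{g}_{\bar 0})$. Global Weyl module. Let $Q^+=\sum_{\alpha\in\Sigma}\mathbb{N}\alpha$ be the positive root lattice of $\mathfrak{g}$. For $\nu\in\Lambda^+$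 and $V$ in $\mathcal{I}(\mathfrak{g}\otimes A,\mathfrak{g}_{\bar 0})$, $V^\nu$ is the unique maximal $\mathfrak{g}\otimes A$-module quotient of $V$ whose weights lie in $\nu-Q^+$, that is, $V^\nu=V/\sum_{\mu\notin\nu-Q^+}U(\mathfrak{g}\otimes A)V_\mu$, where $V_\mu=\{v\in V\mid hv=\mu(h)v\text{ for all }h\in\mathfrak{h}\}$ is the weight space of weight $\mu$. For $\lambda\in\Lambda^+$, $W(\lambda)=P_A(\bar V(\lambda))^\lambda$, and $w_\lambda$ is the image of $v_\lambda$ in $W(\lambda)$.
   Formalization: For sl(n,n) and A(n-1,n-1), weights are taken for the Cartan subalgebra of gl(n,n), acting compatibly on P_A(V̄(λ)) with λ extended to it, instead of for 𝔥: restricted to 𝔥, Q⁺ can be the whole root lattice and the claim fails. *)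

(* Defs.v *)
From HB Require Import structures.
From mathcomp Require Import all_boot all_order all_algebra.
From mathcomp Require Import boolp ring.

Set Implicit Arguments.
Unset Strict Implicit.
Unset Printing Implicit Defensive.

Import GRing.Theory.
Local Open Scope ring_scope.
Local Open Scope quotient_scope.

(* [false] stands for the parity 0 and [true] for the parity 1. *)
Definition sgn (F : fieldType) (p q : bool) : F := (-1) ^+ (p && q).

Record lie_super (F : fieldType) (L : lmodType F) := LieSuper {
  par : bool -> L -> Prop;
  brk : L -> L -> L;
  par0 : forall p, par p 0;
  parP : forall p c x y, par p x -> par p y -> par p (c *: x + y);
  par_split : forall x, exists x0 x1, [/\ par false x0, par true x1 & x = x0 + x1];
  par_direct : forall x, par false x -> par true x -> x = 0;
  brkPl : forall c x y z, brk (c *: x + y) z = c *: brk x z + brk y z;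
  brkPr : forall c x y z, brk x (c *: y + z) = c *: brk x y + brk x z;
  par_brk : forall p q x y, par p x -> par q y -> par (p (+) q) (brk x y);
  brk_anti : forall p q x y, par p x -> par q y ->
    brk x y = - (sgn F p q *: brk y x);
  brk_jacobi : forall p q r x y z, par p x -> par q y -> par r z ->
    brk x (brk y z) = brk (brk x y) z + sgn F p q *: brk y (brk x z)
}.

(* The enveloping superalgebra Uenv S of L: formal expressions in the elements of
   L and the scalars, modulo the laws of unital associative F-algebras, the
   linearity of L -> Uenv S, and xy - (-1)^(p q) yx = [x, y] for x, y homogeneous
   of parities p, q. *)
Inductive uterm (F : fieldType) (L : lmodType F) : Type :=
| UGen of L
| UScal of F
| UAdd of uterm L & uterm L
| UMul of uterm L & uterm L.

Arguments UScal {F L}.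

HB.instance Definition _ (F : fieldType) (L : lmodType F) :=
  gen_eqMixin (uterm L).
HB.instance Definition _ (F : fieldType) (L : lmodType F) :=
  gen_choiceMixin (uterm L).

Inductive ueq (F : fieldType) (L : lmodType F) (S : lie_super L) :
    uterm L -> uterm L -> Prop :=
| ueq_refl a : ueq S a a
| ueq_sym a b : ueq S a b -> ueq S b a
| ueq_trans a b c : ueq S a b -> ueq S b c -> ueq S a c
| ueq_add a a' b b' : ueq S a a' -> ueq S b b' -> ueq S (UAdd a b) (UAdd a' b')
| ueq_mul a a' b b' : ueq S a a' -> ueq S b b' -> ueq S (UMul a b) (UMul a' b')
| ueq_addA a b c : ueq S (UAdd a (UAdd b c)) (UAdd (UAdd a b) c)
| ueq_addC a b : ueq S (UAdd a b) (UAdd b a)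
| ueq_add0 a : ueq S (UAdd (UScal 0) a) a
| ueq_addN a : ueq S (UAdd (UMul (UScal (-1)) a) a) (UScal 0)
| ueq_mulA a b c : ueq S (UMul a (UMul b c)) (UMul (UMul a b) c)
| ueq_mul1 a : ueq S (UMul (UScal 1) a) a
| ueq_mulDl a b c : ueq S (UMul (UAdd a b) c) (UAdd (UMul a c) (UMul b c))
| ueq_mulDr a b c : ueq S (UMul a (UAdd b c)) (UAdd (UMul a b) (UMul a c))
| ueq_scalD c d : ueq S (UScal (c + d)) (UAdd (UScal c) (UScal d))
| ueq_scalM c d : ueq S (UScal (c * d)) (UMul (UScal c) (UScal d))
| ueq_scalC c a : ueq S (UMul (UScal c) a) (UMul a (UScal c))
| ueq_gen c x y :
    ueq S (UGen (c *: x + y)) (UAdd (UMul (UScal c) (UGen x)) (UGen y))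
| ueq_brk p q x y : par S p x -> par S q y ->
    ueq S (UGen (brk S x y))
          (UAdd (UMul (UGen x) (UGen y))
                (UMul (UScal (- sgn F p q)) (UMul (UGen y) (UGen x)))).

Definition ueqb (F : fieldType) (L : lmodType F) (S : lie_super L) :
  rel (uterm L) := fun a b => `[< ueq S a b >].

Lemma ueqb_refl (F : fieldType) (L : lmodType F) (S : lie_super L) :
  reflexive (ueqb S).
Proof. by move=> a; apply/asboolP; apply: ueq_refl. Qed.

Lemma ueqb_sym (F : fieldType) (L : lmodType F) (S : lie_super L) :
  symmetric (ueqb S).
Proof. by move=> a b; apply/asboolP/asboolP; apply: ueq_sym. Qed.

Lemma ueqb_trans (F : fieldType) (L : lmodType F) (S : lie_super L) :
  transitive (ueqb S).
Proof.
by move=> b a c /asboolP ab /asboolP bc; apply/asboolP; apply: ueq_trans bc.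
Qed.

Canonical ueqb_equiv (F : fieldType) (L : lmodType F) (S : lie_super L) :=
  EquivRel (ueqb S) (@ueqb_refl F L S) (@ueqb_sym F L S) (@ueqb_trans F L S).

Definition Uenv (F : fieldType) (L : lmodType F) (S : lie_super L) : Type :=
  {eq_quot ueqb S}.

HB.instance Definition _ (F : fieldType) (L : lmodType F) (S : lie_super L) :=
  Choice.on (Uenv S).

Section UenvOps.
Variables (F : fieldType) (L : lmodType F) (S : lie_super L).
Local Notation U := (Uenv S).

Definition ucl (a : uterm L) : U := \pi_{eq_quot ueqb S} a.

Definition urep (u : U) : uterm L := repr (u : {eq_quot ueqb S}).

Lemma ucl_eq a b : ucl a = ucl b <-> ueq S a b.
Proof.
split=> [/eqmodP/asboolP // | ab].
by apply/eqmodP/asboolP.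
Qed.

Lemma urepK u : ucl (urep u) = u.
Proof. exact: reprK. Qed.

Lemma ucl_rep a : ueq S (urep (ucl a)) a.
Proof. by apply/ucl_eq; rewrite urepK. Qed.

Lemma uclP (P : U -> Prop) : (forall a, P (ucl a)) -> forall u, P u.
Proof. by move=> PP u; rewrite -(urepK u). Qed.

Definition uadd (u v : U) : U := ucl (UAdd (urep u) (urep v)).
Definition umul (u v : U) : U := ucl (UMul (urep u) (urep v)).
Definition uopp (u : U) : U := ucl (UMul (UScal (-1)) (urep u)).

Lemma uclD a b : ucl (UAdd a b) = uadd (ucl a) (ucl b).
Proof. by apply/ucl_eq/ueq_add; apply: ueq_sym; apply: ucl_rep. Qed.

Lemma uclM a b : ucl (UMul a b) = umul (ucl a) (ucl b).
Proof. by apply/ucl_eq/ueq_mul; apply: ueq_sym; apply: ucl_rep. Qed.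

Lemma uclN a : ucl (UMul (UScal (-1)) a) = uopp (ucl a).
Proof.
by apply/ucl_eq/ueq_mul; [apply: ueq_refl | apply: ueq_sym; apply: ucl_rep].
Qed.

Fact uaddA : associative uadd.
Proof.
elim/uclP => a; elim/uclP => b; elim/uclP => c.
by rewrite -!uclD; apply/ucl_eq/ueq_addA.
Qed.

Fact uaddC : commutative uadd.
Proof.
by elim/uclP => a; elim/uclP => b; rewrite -!uclD; apply/ucl_eq/ueq_addC.
Qed.

Fact uadd0 : left_id (ucl (UScal 0)) uadd.
Proof. by elim/uclP => a; rewrite -!uclD; apply/ucl_eq/ueq_add0. Qed.

Fact uaddN : left_inverse (ucl (UScal 0)) uopp uadd.
Proof. by elim/uclP => a; rewrite -uclN -!uclD; apply/ucl_eq/ueq_addN. Qed.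

HB.instance Definition _ := GRing.isZmodule.Build U uaddA uaddC uadd0 uaddN.

Fact umulA : associative umul.
Proof.
elim/uclP => a; elim/uclP => b; elim/uclP => c.
by rewrite -!uclM; apply/ucl_eq/ueq_mulA.
Qed.

Fact umul1 : left_id (ucl (UScal 1)) umul.
Proof. by elim/uclP => a; rewrite -!uclM; apply/ucl_eq/ueq_mul1. Qed.

Fact umulr1 : right_id (ucl (UScal 1)) umul.
Proof.
elim/uclP => a; rewrite -!uclM; apply/ucl_eq.
by apply: ueq_trans (ueq_mul1 S a); apply: ueq_sym; apply: ueq_scalC.
Qed.

Fact umulDl : left_distributive umul +%R.
Proof.
elim/uclP => a; elim/uclP => b; elim/uclP => c.
have E (u v : U) : u + v = uadd u v by [].
rewrite !E -(uclD a b) -!uclM -(uclD (UMul a c)).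
exact/ucl_eq/ueq_mulDl.
Qed.

Fact umulDr : right_distributive umul +%R.
Proof.
elim/uclP => a; elim/uclP => b; elim/uclP => c.
have E (u v : U) : u + v = uadd u v by [].
rewrite !E -(uclD b c) -!uclM -(uclD (UMul a b)).
exact/ucl_eq/ueq_mulDr.
Qed.

HB.instance Definition _ :=
  GRing.Zmodule_isPzRing.Build U umulA umul1 umulr1 umulDl umulDr.

Definition ugen (x : L) : U := ucl (UGen x).
Definition uscal (c : F) : U := ucl (UScal c).

Lemma ugenP c x y : ugen (c *: x + y) = uscal c * ugen x + ugen y.
Proof.
rewrite -[_ * _]uclM -[RHS]uclD; exact/ucl_eq/ueq_gen.
Qed.

Lemma ugen_brk p q x y : par S p x -> par S q y ->
  ugen (brk S x y) = ugen x * ugen y - uscal (sgn F p q) * (ugen y * ugen x).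
Proof.
move=> px qy.
have -> : - (uscal (sgn F p q) * (ugen y * ugen x)) =
          uscal (- sgn F p q) * (ugen y * ugen x).
  rewrite -mulNr; congr (_ * _); rewrite -[LHS]uclN; apply/ucl_eq.
  apply: ueq_trans (ueq_sym (ueq_scalM _ _ _)) _.
  by rewrite mulN1r; apply: ueq_refl.
rewrite -[ugen y * ugen x]uclM -[ugen x * ugen y]uclM -[_ * _]uclM -[RHS]uclD.
exact/ucl_eq/ueq_brk.
Qed.

Lemma uscalD c d : uscal (c + d) = uscal c + uscal d.
Proof. rewrite -[RHS]uclD; exact/ucl_eq/ueq_scalD. Qed.

Lemma uscalM c d : uscal (c * d) = uscal c * uscal d.
Proof. rewrite -[RHS]uclM; exact/ucl_eq/ueq_scalM. Qed.

Lemma uscalC c u : uscal c * u = u * uscal c.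
Proof.
elim/uclP: u => a; rewrite -[LHS]uclM -[RHS]uclM; exact/ucl_eq/ueq_scalC.
Qed.

End UenvOps.

Section Span.
Variables (R : pzRingType) (M : lmodType R) (X : M -> Prop).

Inductive submod_gen : M -> Prop :=
| submod_gen0 : submod_gen 0
| submod_gen_cons r x y : X x -> submod_gen y -> submod_gen (r *: x + y).

Lemma submod_genD x y : submod_gen x -> submod_gen y -> submod_gen (x + y).
Proof.
move=> sx sy; elim: sx => [|r z w Xz _ IH]; first by rewrite add0r.
by rewrite -addrA; apply: submod_gen_cons.
Qed.

Lemma submod_genZ r x : submod_gen x -> submod_gen (r *: x).
Proof.
elim=> [|s z w Xz _ IH]; first by rewrite scaler0; apply: submod_gen0.
by rewrite scalerDr scalerA; apply: submod_gen_cons.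
Qed.

Lemma submod_genN x : submod_gen x -> submod_gen (- x).
Proof. by rewrite -scaleN1r; apply: submod_genZ. Qed.

Definition qmodb : rel M := fun x y => `[< submod_gen (x - y) >].

Lemma qmodb_refl : reflexive qmodb.
Proof. by move=> x; apply/asboolP; rewrite subrr; apply: submod_gen0. Qed.

Lemma qmodb_sym : symmetric qmodb.
Proof.
by move=> x y; apply/asboolP/asboolP => /submod_genN; rewrite opprB.
Qed.

Lemma qmodb_trans : transitive qmodb.
Proof.
move=> y x z /asboolP xy /asboolP yz; apply/asboolP.
by have := submod_genD xy yz; rewrite addrA subrK.
Qed.

Canonical qmodb_equiv := EquivRel qmodb qmodb_refl qmodb_sym qmodb_trans.

(* The quotient of M by the submodule spanned by X. *)
Definition qmod : Type := {eq_quot qmodb}.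

HB.instance Definition _ := Choice.on qmod.

Definition qcl (x : M) : qmod := \pi_{eq_quot qmodb} x.

Definition qrep (u : qmod) : M := repr (u : {eq_quot qmodb}).

Lemma qcl_eq x y : qcl x = qcl y <-> submod_gen (x - y).
Proof. by split=> [/eqmodP/asboolP // | xy]; apply/eqmodP/asboolP. Qed.

Lemma qrepK u : qcl (qrep u) = u.
Proof. exact: reprK. Qed.

Lemma qclP (P : qmod -> Prop) : (forall x, P (qcl x)) -> forall u, P u.
Proof. by move=> PP u; rewrite -(qrepK u). Qed.

Lemma qrep_cl x : submod_gen (qrep (qcl x) - x).
Proof. by apply/qcl_eq; rewrite qrepK. Qed.

Definition qadd (u v : qmod) : qmod := qcl (qrep u + qrep v).
Definition qopp (u : qmod) : qmod := qcl (- qrep u).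
Definition qscale (r : R) (u : qmod) : qmod := qcl (r *: qrep u).

Let qaddE x y : qadd (qcl x) (qcl y) = qcl (x + y).
Proof. by apply/qcl_eq; rewrite opprD addrACA; apply: submod_genD; apply: qrep_cl. Qed.

Let qoppE x : qopp (qcl x) = qcl (- x).
Proof. by apply/qcl_eq; rewrite -opprD; apply/submod_genN/qrep_cl. Qed.

Let qscaleE r x : qscale r (qcl x) = qcl (r *: x).
Proof. by apply/qcl_eq; rewrite -scalerBr; apply/submod_genZ/qrep_cl. Qed.

Fact qaddA : associative qadd.
Proof.
by elim/qclP=> x; elim/qclP=> y; elim/qclP=> z; rewrite !qaddE addrA.
Qed.

Fact qaddC : commutative qadd.
Proof. by elim/qclP=> x; elim/qclP=> y; rewrite !qaddE addrC. Qed.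

Fact qadd0 : left_id (qcl 0) qadd.
Proof. by elim/qclP=> x; rewrite qaddE add0r. Qed.

Fact qaddN : left_inverse (qcl 0) qopp qadd.
Proof. by elim/qclP=> x; rewrite qoppE qaddE addNr. Qed.

HB.instance Definition _ := GRing.isZmodule.Build qmod qaddA qaddC qadd0 qaddN.

Fact qscaleA a b v : qscale a (qscale b v) = qscale (a * b) v.
Proof. by elim/qclP: v => x; rewrite !qscaleE scalerA. Qed.

Fact qscale1 : left_id 1 qscale.
Proof. by elim/qclP=> x; rewrite qscaleE scale1r. Qed.

Fact qscaleDr : right_distributive qscale +%R.
Proof.
move=> r; elim/qclP=> x; elim/qclP=> y.
rewrite -[qcl x + qcl y]/(qadd _ _) -[RHS]/(qadd _ _).
by rewrite !(qaddE, qscaleE) scalerDr.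
Qed.

Fact qscaleDl v : {morph qscale^~ v : a b / a + b}.
Proof.
move=> a b; elim/qclP: v => x; rewrite -[RHS]/(qadd _ _).
by rewrite !(qaddE, qscaleE) scalerDl.
Qed.

HB.instance Definition _ :=
  GRing.Zmodule_isLmodule.Build R qmod qscaleA qscale1 qscaleDr qscaleDl.

Fact qcl_is_linear : linear qcl.
Proof.
move=> r x y; rewrite -[RHS]/(qadd (qscale _ _) _).
by rewrite qscaleE qaddE.
Qed.

HB.instance Definition _ := GRing.isLinear.Build R M qmod *:%R qcl qcl_is_linear.

End Span.

Arguments qcl {R M} X x.

Inductive tterm (R V : Type) : Type :=
| TPure of R & V
| TZero
| TOpp of tterm R V
| TAdd of tterm R V & tterm R V.

Arguments TZero {R V}.

HB.instance Definition _ (R V : Type) := gen_eqMixin (tterm R V).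
HB.instance Definition _ (R V : Type) := gen_choiceMixin (tterm R V).

Inductive teq (S R : pzRingType) (f : S -> R) (V : lmodType S) :
    tterm R V -> tterm R V -> Prop :=
| teq_refl a : teq f a a
| teq_sym a b : teq f a b -> teq f b a
| teq_trans a b c : teq f a b -> teq f b c -> teq f a c
| teq_opp a b : teq f a b -> teq f (TOpp a) (TOpp b)
| teq_add a a' b b' : teq f a a' -> teq f b b' -> teq f (TAdd a b) (TAdd a' b')
| teq_addA a b c : teq f (TAdd a (TAdd b c)) (TAdd (TAdd a b) c)
| teq_addC a b : teq f (TAdd a b) (TAdd b a)
| teq_add0 a : teq f (TAdd TZero a) a
| teq_addN a : teq f (TAdd (TOpp a) a) TZero
| teq_Dl r r' v : teq f (TPure (r + r') v) (TAdd (TPure r v) (TPure r' v))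
| teq_Dr r v v' : teq f (TPure r (v + v')) (TAdd (TPure r v) (TPure r v'))
| teq_bal r s v : teq f (TPure (r * f s) v) (TPure r (s *: v)).

Section ExtScal.
Variables (S R : pzRingType) (f : S -> R) (V : lmodType S).

Definition teqb : rel (tterm R V) := fun a b => `[< teq f a b >].

Lemma teqb_refl : reflexive teqb.
Proof. by move=> a; apply/asboolP; apply: teq_refl. Qed.

Lemma teqb_sym : symmetric teqb.
Proof. by move=> a b; apply/asboolP/asboolP; apply: teq_sym. Qed.

Lemma teqb_trans : transitive teqb.
Proof.
by move=> b a c /asboolP ab /asboolP bc; apply/asboolP; apply: teq_trans bc.
Qed.

Canonical teqb_equiv := EquivRel teqb teqb_refl teqb_sym teqb_trans.

(* The tensor product R (x)_S V, where S acts on the right of R through f. *)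
Definition ext_scal : Type := {eq_quot teqb}.

HB.instance Definition _ := Choice.on ext_scal.

Definition tcl (a : tterm R V) : ext_scal := \pi_{eq_quot teqb} a.

Definition trep (u : ext_scal) : tterm R V := repr (u : {eq_quot teqb}).

Lemma tcl_eq a b : tcl a = tcl b <-> teq f a b.
Proof. by split=> [/eqmodP/asboolP // | ab]; apply/eqmodP/asboolP. Qed.

Lemma trepK u : tcl (trep u) = u.
Proof. exact: reprK. Qed.

Lemma tclP (P : ext_scal -> Prop) : (forall a, P (tcl a)) -> forall u, P u.
Proof. by move=> PP u; rewrite -(trepK u). Qed.

Lemma trep_cl a : teq f (trep (tcl a)) a.
Proof. by apply/tcl_eq; rewrite trepK. Qed.

Fixpoint tmul (r : R) (a : tterm R V) : tterm R V :=
  match a with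
  | TPure r' v => TPure (r * r') v
  | TZero => TZero
  | TOpp b => TOpp (tmul r b)
  | TAdd b c => TAdd (tmul r b) (tmul r c)
  end.

Lemma tmul_teq r a b : teq f a b -> teq f (tmul r a) (tmul r b).
Proof.
elim=> {a b} /=.
- by move=> a; apply: teq_refl.
- by move=> a b _; apply: teq_sym.
- by move=> a b c _ ab _; apply: teq_trans.
- by move=> a b _; apply: teq_opp.
- by move=> a a' b b' _ ? _; apply: teq_add.
- by move=> a b c; apply: teq_addA.
- by move=> a b; apply: teq_addC.
- by move=> a; apply: teq_add0.
- by move=> a; apply: teq_addN.
- by move=> r1 r2 v; rewrite mulrDr; apply: teq_Dl.
- by move=> r1 v v'; apply: teq_Dr.
- by move=> r1 s v; rewrite mulrA; apply: teq_bal.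
Qed.

Definition tadd (u v : ext_scal) : ext_scal := tcl (TAdd (trep u) (trep v)).
Definition topp (u : ext_scal) : ext_scal := tcl (TOpp (trep u)).
Definition tscale (r : R) (u : ext_scal) : ext_scal := tcl (tmul r (trep u)).

Let taddE a b : tadd (tcl a) (tcl b) = tcl (TAdd a b).
Proof. by apply/tcl_eq/teq_add; apply: trep_cl. Qed.

Let toppE a : topp (tcl a) = tcl (TOpp a).
Proof. by apply/tcl_eq/teq_opp; apply: trep_cl. Qed.

Let tscaleE r a : tscale r (tcl a) = tcl (tmul r a).
Proof. by apply/tcl_eq/tmul_teq; apply: trep_cl. Qed.

Fact taddA : associative tadd.
Proof.
elim/tclP=> a; elim/tclP=> b; elim/tclP=> c; rewrite !taddE.
exact/tcl_eq/teq_addA.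
Qed.

Fact taddC : commutative tadd.
Proof.
elim/tclP=> a; elim/tclP=> b; rewrite !taddE; exact/tcl_eq/teq_addC.
Qed.

Fact tadd0 : left_id (tcl TZero) tadd.
Proof. elim/tclP=> a; rewrite taddE; exact/tcl_eq/teq_add0. Qed.

Fact taddN : left_inverse (tcl TZero) topp tadd.
Proof. elim/tclP=> a; rewrite toppE taddE; exact/tcl_eq/teq_addN. Qed.

HB.instance Definition _ := GRing.isZmodule.Build ext_scal taddA taddC tadd0 taddN.

Lemma tclD a b : tcl (TAdd a b) = tcl a + tcl b.
Proof. by rewrite -taddE. Qed.

Lemma tclN a : tcl (TOpp a) = - tcl a.
Proof. by rewrite -toppE. Qed.

Fact tscaleA a b v : tscale a (tscale b v) = tscale (a * b) v.
Proof.
elim/tclP: v => x; rewrite !tscaleE; congr tcl.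
by elim: x => //= [r v | x -> | x -> y ->] //; rewrite mulrA.
Qed.

Fact tscale1 : left_id 1 tscale.
Proof.
elim/tclP=> x; rewrite tscaleE; congr tcl.
by elim: x => //= [r v | x -> | x -> y ->] //; rewrite mul1r.
Qed.

Fact tscaleDr : right_distributive tscale +%R.
Proof.
by move=> r; elim/tclP=> x; elim/tclP=> y; rewrite -tclD !tscaleE -tclD.
Qed.

Fact tscaleDl v : {morph tscale^~ v : a b / a + b}.
Proof.
move=> a b; elim/tclP: v => x; rewrite !tscaleE.
elim: x => /= [r v | | x IH | x IHx y IHy].
- by rewrite mulrDl -tclD; apply/tcl_eq/teq_Dl.
- have -> : tcl TZero = 0 by [].
  by rewrite addr0.
- by rewrite !tclN IH opprD.
- by rewrite !tclD IHx IHy addrACA.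
Qed.

HB.instance Definition _ :=
  GRing.Zmodule_isLmodule.Build R ext_scal tscaleA tscale1 tscaleDr tscaleDl.

Definition pure (r : R) (v : V) : ext_scal := tcl (TPure r v).

Lemma pureDl r r' v : pure (r + r') v = pure r v + pure r' v.
Proof. by rewrite -tclD; apply/tcl_eq/teq_Dl. Qed.

Lemma pureDr r v v' : pure r (v + v') = pure r v + pure r v'.
Proof. by rewrite -tclD; apply/tcl_eq/teq_Dr. Qed.

Lemma pure_bal r s v : pure (r * f s) v = pure r (s *: v).
Proof. exact/tcl_eq/teq_bal. Qed.

Lemma pureZ r r' v : r *: pure r' v = pure (r * r') v.
Proof. by rewrite -[LHS]/(tscale _ _) tscaleE. Qed.

End ExtScal.

Section Current.
Variables (F : fieldType) (g : vectType F) (S : lie_super g) (A : comAlgType F).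

Local Notation n := (\dim (fullv : {vspace g})).
Local Notation e := (vbasis (fullv : {vspace g})).

(* The tensor product of g and A over F, as A-valued coordinates in a basis
   of g. *)
Definition gten : Type := {ffun 'I_n -> A}.

HB.instance Definition _ := GRing.Lmodule.on gten.

Definition ten (x : g) (a : A) : gten := [ffun i => coord e i x *: a].

Lemma tenPl c x y a : ten (c *: x + y) a = c *: ten x a + ten y a.
Proof.
apply/ffunP => i; rewrite !ffunE linearP scalerDl.
by rewrite scalerA.
Qed.

Lemma tenPr c x a b : ten x (c *: a + b) = c *: ten x a + ten x b.
Proof.
apply/ffunP => i; rewrite !ffunE scalerDr !scalerA [coord _ _ _ * c]mulrC.
by [].
Qed.

Lemma ten0l a : ten 0 a = 0.
Proof. by apply/ffunP => i; rewrite !ffunE linear0 scale0r. Qed.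

Lemma ten0r x : ten x 0 = 0.
Proof. by apply/ffunP => i; rewrite !ffunE scaler0. Qed.

Lemma tenDl x y a : ten (x + y) a = ten x a + ten y a.
Proof. by rewrite -[x]scale1r tenPl !scale1r. Qed.

Lemma tenZl c x a : ten (c *: x) a = c *: ten x a.
Proof. by rewrite -[c *: x]addr0 tenPl ten0l addr0. Qed.

Lemma tenDr x a b : ten x (a + b) = ten x a + ten x b.
Proof. by rewrite -[a]scale1r tenPr !scale1r. Qed.

Lemma tenZr c x a : ten x (c *: a) = c *: ten x a.
Proof. by rewrite -[c *: a]addr0 tenPr ten0r addr0. Qed.

Lemma ten_suml I (r : seq I) (G : I -> g) a :
  ten (\sum_(i <- r) G i) a = \sum_(i <- r) ten (G i) a.
Proof.
elim: r => [|i r IH]; first by rewrite !big_nil ten0l.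
by rewrite !big_cons tenDl IH.
Qed.

Lemma ten_sumr I (r : seq I) x (G : I -> A) :
  ten x (\sum_(i <- r) G i) = \sum_(i <- r) ten x (G i).
Proof.
elim: r => [|i r IH]; first by rewrite !big_nil ten0r.
by rewrite !big_cons tenDr IH.
Qed.

Lemma gten_sum (u : gten) : u = \sum_(i < n) ten e`_i (u i).
Proof.
apply/ffunP => j; rewrite sum_ffunE (bigD1 j) //= big1 ?addr0 => [|i ij].
  by rewrite !ffunE coord_free ?(basis_free (vbasisP _)) // eqxx scale1r.
rewrite !ffunE coord_free ?(basis_free (vbasisP _)) //.
by rewrite (negbTE (_ : _ != _)) ?scale0r // eq_sym.
Qed.

Lemma gten_ind (P : gten -> Prop) :
  P 0 -> (forall x a u, P u -> P (ten x a + u)) -> forall u, P u.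
Proof.
move=> P0 PS u; rewrite (gten_sum u).
by apply: (big_rec P) => // i w _; apply: PS.
Qed.

(* For a subspace N of g, the subspace of g (x) A spanned by the x (x) a with
   x in N. *)
Inductive sub_ten (N : g -> Prop) : gten -> Prop :=
| sub_ten0 : sub_ten N 0
| sub_ten_cons x a u : N x -> sub_ten N u -> sub_ten N (ten x a + u).

Definition ten_brk (u v : gten) : gten :=
  \sum_(i < n) \sum_(j < n) ten (brk S e`_i e`_j) (u i * v j).

Lemma sgnC p q : sgn F p q = sgn F q p. Proof. by rewrite /sgn andbC. Qed.

Lemma brk0l x : brk S 0 x = 0.
Proof.
have := brkPl S 0 0 0 x; rewrite !scale0r !add0r => _.
by have := brkPl S (-1) 0 0 x; rewrite scaler0 addr0 scaleN1r addNr.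
Qed.

Lemma brk0r x : brk S x 0 = 0.
Proof. by have := brkPr S (-1) x 0 0; rewrite scaler0 addr0 scaleN1r addNr. Qed.

Lemma brkDl x y z : brk S (x + y) z = brk S x z + brk S y z.
Proof. by rewrite -[x]scale1r brkPl !scale1r. Qed.

Lemma brkDr x y z : brk S x (y + z) = brk S x y + brk S x z.
Proof. by rewrite -[y]scale1r brkPr !scale1r. Qed.

Lemma brkZl c x z : brk S (c *: x) z = c *: brk S x z.
Proof. by rewrite -[c *: x]addr0 brkPl brk0l addr0. Qed.

Lemma brkZr c x z : brk S x (c *: z) = c *: brk S x z.
Proof. by rewrite -[c *: z]addr0 brkPr brk0r addr0. Qed.

Lemma brk_sumr I (r : seq I) x (G : I -> g) :
  brk S x (\sum_(i <- r) G i) = \sum_(i <- r) brk S x (G i).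
Proof.
elim: r => [|i r IH]; first by rewrite !big_nil brk0r.
by rewrite !big_cons brkDr IH.
Qed.

Lemma brk_suml I (r : seq I) x (G : I -> g) :
  brk S (\sum_(i <- r) G i) x = \sum_(i <- r) brk S (G i) x.
Proof.
elim: r => [|i r IH]; first by rewrite !big_nil brk0l.
by rewrite !big_cons brkDl IH.
Qed.

Lemma ten_brkPl c u v w : ten_brk (c *: u + v) w = c *: ten_brk u w + ten_brk v w.
Proof.
rewrite /ten_brk scaler_sumr -big_split; apply: eq_bigr => i _ /=.
rewrite scaler_sumr -big_split; apply: eq_bigr => j _ /=.
by rewrite !ffunE mulrDl -scalerAl tenPr.
Qed.

Lemma ten_brkPr c u v w : ten_brk u (c *: v + w) = c *: ten_brk u v + ten_brk u w.
Proof.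
rewrite /ten_brk scaler_sumr -big_split; apply: eq_bigr => i _ /=.
rewrite scaler_sumr -big_split; apply: eq_bigr => j _ /=.
by rewrite !ffunE mulrDr -scalerAr tenPr.
Qed.

Lemma ten_brkE x a y b : ten_brk (ten x a) (ten y b) = ten (brk S x y) (a * b).
Proof.
have xE (z : g) : z = \sum_(i < n) coord e i z *: e`_i.
  exact: coord_basis (vbasisP _) (memvf z).
rewrite [in RHS](xE x) [in RHS](xE y) brk_suml ten_suml.
apply: eq_bigr => i _; rewrite brk_sumr ten_suml; apply: eq_bigr => j _.
rewrite !ffunE -scalerAl -scalerAr !tenZr brkZl brkZr !tenZl //.
Qed.

Lemma ten_brk0l u : ten_brk 0 u = 0.
Proof. by have := ten_brkPl (-1) 0 0 u; rewrite scaler0 addr0 scaleN1r addNr. Qed.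

Lemma ten_brk0r u : ten_brk u 0 = 0.
Proof. by have := ten_brkPr (-1) u 0 0; rewrite scaler0 addr0 scaleN1r addNr. Qed.

Lemma ten_brkDl u v w : ten_brk (u + v) w = ten_brk u w + ten_brk v w.
Proof. by rewrite -[u]scale1r ten_brkPl !scale1r. Qed.

Lemma ten_brkDr u v w : ten_brk u (v + w) = ten_brk u v + ten_brk u w.
Proof. by rewrite -[v]scale1r ten_brkPr !scale1r. Qed.

Definition ten_par (p : bool) : gten -> Prop := sub_ten (par S p).

Fact ten_par0 p : ten_par p 0.
Proof. exact: sub_ten0. Qed.

Lemma parZ p c x : par S p x -> par S p (c *: x).
Proof. by move=> px; rewrite -[c *: x]addr0; apply: parP => //; apply: par0. Qed.

Fact ten_parP p c u v : ten_par p u -> ten_par p v -> ten_par p (c *: u + v).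
Proof.
move=> pu pv; elim: pu => [|x a w px _ IH]; first by rewrite scaler0 add0r.
by rewrite scalerDr -addrA -tenZl; apply: sub_ten_cons => //; apply: parZ.
Qed.

Lemma ten_par1 p x a : par S p x -> ten_par p (ten x a).
Proof.
by move=> px; rewrite -[ten x a]addr0; apply: sub_ten_cons => //; apply: sub_ten0.
Qed.

Lemma ten_parD p u v : ten_par p u -> ten_par p v -> ten_par p (u + v).
Proof. by move=> pu pv; rewrite -[u]scale1r; apply: ten_parP. Qed.

Fact ten_par_split u :
  exists u0 u1, [/\ ten_par false u0, ten_par true u1 & u = u0 + u1].
Proof.
elim/gten_ind: u => [|x a u [u0 [u1 [p0 p1 ->]]]].
  by exists 0, 0; split; rewrite ?addr0 //; apply: sub_ten0.
have [x0 [x1 [q0 q1 ->]]] := par_split S x.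
exists (ten x0 a + u0), (ten x1 a + u1); split.
- exact: sub_ten_cons.
- exact: sub_ten_cons.
- by rewrite tenDl addrACA.
Qed.

Let even_part_ex x :
  exists y, par S false y /\ par S true (x - y).
Proof.
have [x0 [x1 [p0 p1 ->]]] := par_split S x; exists x0; split=> //.
by rewrite addrC addKr.
Qed.

Let ev x := sval (cid (even_part_ex x)).

Let evP x : par S false (ev x) /\ par S true (x - ev x).
Proof.
exact: svalP (cid (even_part_ex x)).
Qed.

Let ev_uniq x y : par S false y -> par S true (x - y) -> ev x = y.
Proof.
move=> py pxy; have [pe pxe] := evP x.
apply/eqP; rewrite -subr_eq0; apply/eqP.
apply: (@par_direct _ _ S).
  by rewrite addrC -scaleN1r; apply: parP.
have -> : ev x - y = -1 *: (x - ev x) + (x - y).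
  by rewrite scaleN1r opprB addrA subrK.
exact: parP.
Qed.

Let ev_lin c x y : ev (c *: x + y) = c *: ev x + ev y.
Proof.
have [p1 q1] := evP x; have [p2 q2] := evP y.
apply: ev_uniq; first exact: parP.
by rewrite opprD addrACA -scalerBr; apply: parP.
Qed.

Let evt (u : gten) : gten := \sum_(i < n) ten (ev e`_i) (u i).

Let evtD u v : evt (u + v) = evt u + evt v.
Proof.
rewrite /evt -big_split; apply: eq_bigr => i _ /=.
by rewrite ffunE tenDr.
Qed.

Let evtE x a : evt (ten x a) = ten (ev x) a.
Proof.
have ev0 : ev 0 = 0.
  by have := ev_lin (-1) 0 0; rewrite scaler0 addr0 scaleN1r addNr.
have evD : {morph ev : y z / y + z}.
  by move=> y z; rewrite -[y]scale1r ev_lin !scale1r.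
have xE := coord_basis (vbasisP _) (memvf x).
rewrite [in RHS]xE (big_morph ev evD ev0) ten_suml; apply: eq_bigr => i _.
have := ev_lin (coord e i x) e`_i 0; rewrite ev0 !addr0 => ->.
by rewrite ffunE tenZr tenZl.
Qed.

Let evt0 : evt 0 = 0.
Proof. by rewrite /evt big1 // => i _; rewrite ffunE ten0r. Qed.

Fact ten_par_direct u : ten_par false u -> ten_par true u -> u = 0.
Proof.
move=> p0 p1; have <- : evt u = u.
  elim: p0 => [|x a v px _ IH]; first exact: evt0.
  rewrite evtD IH evtE (@ev_uniq x x) // subrr; exact: par0.
elim: p1 => [|x a v px _ IH]; first exact: evt0.
by rewrite evtD IH evtE (@ev_uniq x 0) ?subr0 ?ten0l ?addr0 //; apply: par0.
Qed.

Fact ten_par_brk p q u v :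
  ten_par p u -> ten_par q v -> ten_par (p (+) q) (ten_brk u v).
Proof.
move=> pu pv; elim: pu => [|x a w px _ IHw].
  by rewrite ten_brk0l; apply: sub_ten0.
rewrite ten_brkDl; apply: ten_parD => //.
elim: pv => [|y b z py _ IHz]; first by rewrite ten_brk0r; apply: sub_ten0.
rewrite ten_brkDr ten_brkE; apply: ten_parD => //.
by apply: ten_par1; apply: par_brk.
Qed.

Fact ten_brk_anti p q u v : ten_par p u -> ten_par q v ->
  ten_brk u v = - (sgn F p q *: ten_brk v u).
Proof.
move=> pu pv; elim: pu => [|x a w px _ IHw].
  by rewrite ten_brk0l ten_brk0r scaler0 oppr0.
rewrite ten_brkDl ten_brkDr scalerDr opprD {}IHw; congr (_ + _).
elim: pv => [|y b z py _ IHz].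
  by rewrite ten_brk0l ten_brk0r scaler0 oppr0.
rewrite ten_brkDl ten_brkDr scalerDr opprD {}IHz; congr (_ + _).
rewrite !ten_brkE (brk_anti px py) -scaleNr tenZl mulrC scaleNr //.
Qed.

Fact ten_brk_jacobi p q r u v w : ten_par p u -> ten_par q v -> ten_par r w ->
  ten_brk u (ten_brk v w) =
  ten_brk (ten_brk u v) w + sgn F p q *: ten_brk v (ten_brk u w).
Proof.
move=> pu pv pw; elim: pu => [|x a u' px _ IHu].
  by rewrite !(ten_brk0l, ten_brk0r) scaler0 addr0.
rewrite !(ten_brkDl, ten_brkDr) scalerDr addrACA {}IHu; congr (_ + _).
elim: pv => [|y b v' py _ IHv].
  by rewrite !(ten_brk0l, ten_brk0r) scaler0 addr0.
rewrite !(ten_brkDl, ten_brkDr) scalerDr addrACA {}IHv; congr (_ + _).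
elim: pw => [|z c w' pz _ IHw].
  by rewrite !(ten_brk0l, ten_brk0r) scaler0 addr0.
rewrite !(ten_brkDl, ten_brkDr) scalerDr addrACA {}IHw; congr (_ + _).
rewrite !ten_brkE (brk_jacobi px py pz) tenDl tenZl !mulrA.
by rewrite [b * a]mulrC.
Qed.

Definition current : lie_super gten :=
  LieSuper ten_par0 ten_parP ten_par_split ten_par_direct ten_brkPl ten_brkPr
    ten_par_brk ten_brk_anti ten_brk_jacobi.

Fixpoint incl_term (a : uterm g) : uterm gten :=
  match a with
  | UGen x => UGen (ten x 1)
  | UScal c => UScal c
  | UAdd a b => UAdd (incl_term a) (incl_term b)
  | UMul a b => UMul (incl_term a) (incl_term b)
  end.

Lemma incl_term_eq a b : ueq S a b -> ueq current (incl_term a) (incl_term b).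
Proof.
elim=> {a b} /=.
- by move=> a; apply: ueq_refl.
- by move=> a b _; apply: ueq_sym.
- by move=> a b c _ ab _; apply: ueq_trans.
- by move=> a a' b b' _ ? _; apply: ueq_add.
- by move=> a a' b b' _ ? _; apply: ueq_mul.
- by move=> a b c; apply: ueq_addA.
- by move=> a b; apply: ueq_addC.
- by move=> a; apply: ueq_add0.
- by move=> a; apply: ueq_addN.
- by move=> a b c; apply: ueq_mulA.
- by move=> a; apply: ueq_mul1.
- by move=> a b c; apply: ueq_mulDl.
- by move=> a b c; apply: ueq_mulDr.
- by move=> c d; apply: ueq_scalD.
- by move=> c d; apply: ueq_scalM.
- by move=> c a; apply: ueq_scalC.
- by move=> c x y; rewrite tenPl; apply: ueq_gen.
- move=> p q x y px qy.
  have -> : ten (brk S x y) 1 = brk current (ten x 1) (ten y 1).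
    by rewrite [RHS]ten_brkE mulr1.
  by apply: ueq_brk; apply: ten_par1.
Qed.

(* U(g) -> U(g (x) A), induced by x |-> x (x) 1. *)
Definition Uincl (u : Uenv S) : Uenv current := ucl current (incl_term (urep u)).

Lemma Uincl_cl a : Uincl (ucl S a) = ucl current (incl_term a).
Proof. exact/ucl_eq/incl_term_eq/ucl_rep. Qed.

Fact Uincl_additive : {morph Uincl : u v / u + v}.
Proof.
elim/uclP=> a; elim/uclP=> b; rewrite -[ucl S a + _]uclD !Uincl_cl.
by rewrite -[RHS]uclD.
Qed.

Fact Uincl_nmod : nmod_morphism Uincl.
Proof. by split; [exact: Uincl_cl | exact: Uincl_additive]. Qed.

Fact Uincl_monoid : monoid_morphism Uincl.
Proof.
split=> [|u v]; first exact: Uincl_cl.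
elim/uclP: u => a; elim/uclP: v => b; rewrite -[ucl S a * _]uclM !Uincl_cl.
by rewrite -[RHS]uclM.
Qed.

End Current.

Section GeneralLinear.
Variables (F : fieldType) (n : nat).
Local Notation M2 := 'M[F]_(n + n).

(* The even (block diagonal) and odd (block antidiagonal) parts of a matrix. *)
Definition mxpart (p : bool) (x : M2) : M2 :=
  if p then block_mx 0 (ursubmx x) (dlsubmx x) 0
  else block_mx (ulsubmx x) 0 0 (drsubmx x).

Definition gl_par (p : bool) (x : M2) : Prop := mxpart p x = x.

Definition gl_brk (x y : M2) : M2 :=
  \sum_(p : bool) \sum_(q : bool)
    (mxpart p x *m mxpart q y - sgn F p q *: (mxpart q y *m mxpart p x)).

Lemma mxpartP p c x y : mxpart p (c *: x + y) = c *: mxpart p x + mxpart p y.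
Proof.
rewrite -[in LHS](submxK x) -[in LHS](submxK y) scale_block_mx add_block_mx.
by case: p; rewrite /mxpart !(block_mxKul, block_mxKur, block_mxKdl, block_mxKdr)
  scale_block_mx add_block_mx !scaler0 !addr0.
Qed.

Lemma mxpart_split x : mxpart false x + mxpart true x = x.
Proof. by rewrite /mxpart add_block_mx !addr0 !add0r submxK. Qed.

Lemma mxpartK p q x : mxpart p (mxpart q x) = if p == q then mxpart q x else 0.
Proof.
have b0 : block_mx 0 0 0 0 = 0 :> M2 by rewrite block_mx0.
by case: p; case: q => /=;
  rewrite /mxpart !(block_mxKul, block_mxKur, block_mxKdl, block_mxKdr).
Qed.

Lemma mxpart_par p q x : gl_par q x -> mxpart p x = if p == q then x else 0.
Proof. by move=> xE; rewrite -{1}xE mxpartK xE. Qed.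

Lemma mxpart0 p : mxpart p 0 = 0.
Proof. by have := mxpartP p (-1) 0 0; rewrite scaler0 addr0 scaleN1r addNr. Qed.

Lemma gl_brkE p q x y : gl_par p x -> gl_par q y ->
  gl_brk x y = x *m y - sgn F p q *: (y *m x).
Proof.
move=> px qy; rewrite /gl_brk !big_bool !(mxpart_par _ px) !(mxpart_par _ qy).
by case: p {px}; case: q {qy} => /=;
  rewrite !(mul0mx, mulmx0, scaler0, subr0, oppr0, addr0, add0r).
Qed.

Lemma gl_par_mul p q x y :
  gl_par p x -> gl_par q y -> gl_par (p (+) q) (x *m y).
Proof.
rewrite /gl_par => <- <-; case: p; case: q; rewrite /mxpart /= mulmx_block;
  rewrite !(mul0mx, mulmx0, addr0, add0r);
  by rewrite !(block_mxKul, block_mxKur, block_mxKdl, block_mxKdr).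
Qed.

Fact gl_par0 p : gl_par p 0.
Proof. exact: mxpart0. Qed.

Fact gl_parP p c x y : gl_par p x -> gl_par p y -> gl_par p (c *: x + y).
Proof. by rewrite /gl_par mxpartP => -> ->. Qed.

Fact gl_par_split x :
  exists x0 x1, [/\ gl_par false x0, gl_par true x1 & x = x0 + x1].
Proof.
exists (mxpart false x), (mxpart true x); split; first 1 last.
- by rewrite /gl_par mxpartK.
- by rewrite mxpart_split.
- by rewrite /gl_par mxpartK.
Qed.

Fact gl_par_direct x : gl_par false x -> gl_par true x -> x = 0.
Proof. by move=> p0 p1; rewrite -[x]p0 (mxpart_par _ p1). Qed.

Fact gl_brkPl c x y z : gl_brk (c *: x + y) z = c *: gl_brk x z + gl_brk y z.
Proof.
rewrite /gl_brk scaler_sumr -big_split; apply: eq_bigr => p _ /=.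
rewrite scaler_sumr -big_split; apply: eq_bigr => q _ /=.
rewrite mxpartP mulmxDl mulmxDr -scalemxAl -scalemxAr scalerDr scalerBr.
by rewrite !scalerA [sgn F p q * c]mulrC opprD addrACA.
Qed.

Fact gl_brkPr c x y z : gl_brk x (c *: y + z) = c *: gl_brk x y + gl_brk x z.
Proof.
rewrite /gl_brk scaler_sumr -big_split; apply: eq_bigr => p _ /=.
rewrite scaler_sumr -big_split; apply: eq_bigr => q _ /=.
rewrite mxpartP mulmxDl mulmxDr -scalemxAl -scalemxAr scalerDr scalerBr.
by rewrite !scalerA [sgn F p q * c]mulrC opprD addrACA.
Qed.

Fact gl_par_brk p q x y :
  gl_par p x -> gl_par q y -> gl_par (p (+) q) (gl_brk x y).
Proof.
move=> px qy; rewrite (gl_brkE px qy) addrC -scaleNr.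
by apply: gl_parP; [rewrite addbC|]; apply: gl_par_mul.
Qed.

Fact gl_brk_anti p q x y : gl_par p x -> gl_par q y ->
  gl_brk x y = - (sgn F p q *: gl_brk y x).
Proof.
move=> px qy; rewrite (gl_brkE px qy) (gl_brkE qy px).
rewrite scalerBr scalerA /sgn [q && p]andbC -expr2 sqrr_sign scale1r opprB //.
Qed.

Fact gl_brk_jacobi p q r x y z : gl_par p x -> gl_par q y -> gl_par r z ->
  gl_brk x (gl_brk y z) =
  gl_brk (gl_brk x y) z + sgn F p q *: gl_brk y (gl_brk x z).
Proof.
move=> px qy rz.
rewrite (gl_brkE px (gl_par_brk qy rz)) (gl_brkE (gl_par_brk px qy) rz).
rewrite (gl_brkE qy (gl_par_brk px rz)) (gl_brkE px qy) (gl_brkE qy rz).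
rewrite (gl_brkE px rz) !mulmxBl !mulmxBr -!scalemxAl -!scalemxAr !mulmxA.
rewrite !scalerBr !scalerA.
have -> : sgn F (p (+) q) r = sgn F p r * sgn F q r.
  by rewrite /sgn -signr_addb; case: p {px}; case: q {qy}; case: r {rz}.
have -> : sgn F p (q (+) r) = sgn F p q * sgn F p r.
  by rewrite /sgn -signr_addb; case: p {px}; case: q {qy}; case: r {rz}.
have -> : sgn F q (p (+) r) = sgn F p q * sgn F q r.
  by rewrite /sgn -signr_addb; case: p {px}; case: q {qy}; case: r {rz}.
have s2 : sgn F p q * sgn F p q = 1 by rewrite /sgn -expr2 sqrr_sign.
rewrite mulrA !s2 !mul1r; apply/matrixP => i j.
have mxE1 c (w : M2) : (c *: w) i j = c * w i j by rewrite mxE.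
have mxE2 (w w' : M2) : (w + w') i j = w i j + w' i j by rewrite mxE.
have mxE3 (w : M2) : (- w) i j = - w i j by rewrite mxE.
rewrite !(mxE1, mxE2, mxE3); ring.
Qed.

Definition gl_super : lie_super M2 :=
  LieSuper gl_par0 gl_parP gl_par_split gl_par_direct gl_brkPl gl_brkPr
    gl_par_brk gl_brk_anti gl_brk_jacobi.

Definition str (x : M2) : F := \tr (ulsubmx x) - \tr (drsubmx x).

End GeneralLinear.

HB.instance Definition _ (F : fieldType) (g : vectType F) (S : lie_super g)
    (A : comAlgType F) :=
  GRing.isNmodMorphism.Build (Uenv S) (Uenv (current S A)) (@Uincl F g S A)
    (@Uincl_nmod F g S A).
HB.instance Definition _ (F : fieldType) (g : vectType F) (S : lie_super g)
    (A : comAlgType F) :=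
  GRing.isMonoidMorphism.Build (Uenv S) (Uenv (current S A)) (@Uincl F g S A)
    (@Uincl_monoid F g S A).

Section Classes.
Variables (F : fieldType) (g : vectType F) (S : lie_super g).

Definition graded_ideal (I : {vspace g}) : Prop :=
  (forall x, x \in I -> exists x0 x1,
     [/\ x0 \in I, x1 \in I, par S false x0, par S true x1 & x = x0 + x1]) /\
  (forall x y, y \in I -> brk S x y \in I).

Definition simple_super : Prop :=
  (exists x y, brk S x y != 0) /\
  (forall I, graded_ideal I -> I = 0%VS \/ I = fullv).

Definition odd_submodule (N : {vspace g}) : Prop :=
  (forall x, x \in N -> par S true x) /\
  (forall x y, par S false x -> y \in N -> brk S x y \in N).

Definition odd_completely_reducible : Prop :=
  forall N, odd_submodule N -> exists N',
    [/\ odd_submodule N', (N :&: N' = 0)%VS &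
        forall x, par S true x -> x \in (N + N')%VS].

(* As usual for basic Lie superalgebras, the form is even. *)
Record nondegenerate_invariant_form (B : g -> g -> F) : Prop := {
  form_linl : forall c x y z, B (c *: x + y) z = c * B x z + B y z;
  form_linr : forall c x y z, B x (c *: y + z) = c * B x y + B x z;
  form_even : forall x y, par S false x -> par S true y -> B x y = 0 /\ B y x = 0;
  form_inv : forall x y z, B (brk S x y) z = B x (brk S y z);
  form_nondeg : forall x, (forall y, B x y = 0) -> x = 0
}.

Definition basic_classical : Prop :=
  [/\ simple_super, odd_completely_reducible &
      exists B, nondegenerate_invariant_form B].

Inductive gen_alg (X : g -> Prop) : g -> Prop :=
| gen_alg_mem x : X x -> gen_alg X x
| gen_alg0 : gen_alg X 0
| gen_alg_lin c x y : gen_alg X x -> gen_alg X y -> gen_alg X (c *: x + y)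
| gen_alg_brk x y : gen_alg X x -> gen_alg X y -> gen_alg X (brk S x y).

(* Cartan subalgebras of the even part: nilpotent and self-normalizing. *)
Record cartan (h : {vspace g}) : Prop := {
  cartan_even : forall t, t \in h -> par S false t;
  cartan_closed : forall t u, t \in h -> u \in h -> brk S t u \in h;
  cartan_nilp : exists k, forall s t, size s = k -> {subset s <= h} -> t \in h ->
    foldr (brk S) t s = 0;
  cartan_norm : forall x, par S false x -> (forall t, t \in h -> brk S t x \in h) ->
    x \in h
}.

Definition hdual (h : {vspace g}) : vectType F := 'Hom(subvs_of h, F^o).

Definition root_space (h : {vspace g}) (p : bool) (a : hdual h) (x : g) : Prop :=
  par S p x /\ forall t : subvs_of h, brk S (vsval t) x = a t *: x.

Definition is_root (h : {vspace g}) (p : bool) (a : hdual h) : Prop :=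
  a != 0 /\ exists2 x, root_space p a x & x != 0.

Record simple_system (h : {vspace g}) (Sigma : seq (hdual h)) (X Y : hdual h -> g)
    : Prop := {
  simple_free : free Sigma;
  simple_root : forall b, b \in Sigma -> exists p,
    [/\ is_root p b, root_space p b (X b) & root_space p (- b) (Y b)];
  simple_gen : forall x, gen_alg (fun y =>
    y \in h \/ exists2 b, b \in Sigma & y = X b \/ y = Y b) x;
  simple_orth : forall b b', b \in Sigma -> b' \in Sigma -> b != b' ->
    brk S (X b) (Y b') = 0
}.

End Classes.

Definition Qplus (F : fieldType) (V : vectType F) (Sigma : seq V) (a : V) : Prop :=
  exists c : V -> nat, a = \sum_(b <- Sigma) b *+ c b.

(* pi identifies g with the quotient of sl(n,n) by the subspace Z; only its
   values on sl(n,n) matter. *)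
Record sl_quotient (F : fieldType) (n : nat) (Z : 'M[F]_(n + n) -> Prop)
    (g : vectType F) (S : lie_super g) (pi : {linear 'M[F]_(n + n) -> g})
    : Prop := {
  slq_par : forall p x, str x = 0 -> gl_par p x -> par S p (pi x);
  slq_brk : forall x y, str x = 0 -> str y = 0 ->
    pi (gl_brk x y) = brk S (pi x) (pi y);
  slq_onto : forall y, exists2 x, str x = 0 & pi x = y;
  slq_ker : forall x, str x = 0 -> (pi x = 0 <-> Z x)
}.

Definition is_sl (F : fieldType) (n : nat) (g : vectType F) (S : lie_super g) pi :=
  sl_quotient (fun x : 'M[F]_(n + n) => x = 0) S pi.

Definition is_psl (F : fieldType) (n : nat) (g : vectType F) (S : lie_super g) pi :=
  sl_quotient (fun x : 'M[F]_(n + n) => is_scalar_mx x) S pi.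

(* The roots and the simple system live on (rd_hat, rd_cartan), which is g
   itself with its Cartan subalgebra, or gl(n,n) when g is sl(n,n) or
   A(n-1,n-1).  The map rd_pi restricts to a surjection from the subalgebra
   rd_dom of rd_hat onto g. *)
Record root_datum (F : fieldType) := RootDatum {
  rd_hat : vectType F;
  rd_hatS : lie_super rd_hat;
  rd_cartan : {vspace rd_hat};
  rd_Sigma : seq (hdual rd_cartan);
  rd_X : hdual rd_cartan -> rd_hat;
  rd_Y : hdual rd_cartan -> rd_hat;
  rd_dom : rd_hat -> Prop;
  rd_g : vectType F;
  rd_S : lie_super rd_g;
  rd_pi : {linear rd_hat -> rd_g};
  rd_h : {vspace rd_g}
}.

Inductive admissible (F : fieldType) : root_datum F -> Prop :=
| admissible_basic (g : vectType F) (S : lie_super g) (h : {vspace g}) Sigma X Y :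
    basic_classical S ->
    (forall n pi, (1 < n)%N -> ~ is_psl (n := n) S pi) ->
    cartan S h -> simple_system S Sigma X Y ->
    admissible (@RootDatum F g S h Sigma X Y (fun=> True) g S idfun h)
| admissible_sl n (h : {vspace 'M[F]_(n + n)}) Sigma X Y
    (g : vectType F) (S : lie_super g) (pi : {linear 'M[F]_(n + n) -> g}) :
    (1 < n)%N -> is_sl S pi \/ is_psl S pi ->
    cartan (gl_super F n) h -> simple_system (gl_super F n) Sigma X Y ->
    admissible (@RootDatum F _ (gl_super F n) h Sigma X Y (fun x => str x = 0)
      g S pi <<[seq pi (gl_brk (X b) (Y b)) | b <- Sigma]>>%VS).

Section Weyl.
Variables (F : fieldType) (G : root_datum F).

Local Notation hatg := (rd_hat G).
Local Notation hatS := (rd_hatS G).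
Local Notation hath := (rd_cartan G).
Local Notation hatd := (hdual hath).
Local Notation Sigma := (rd_Sigma G).
Local Notation g := (rd_g G).
Local Notation S := (rd_S G).
Local Notation pi := (rd_pi G).
Local Notation h := (rd_h G).

Definition nplus : g -> Prop :=
  gen_alg S (fun y => exists2 b, b \in Sigma & y = pi (rd_X b)).

Definition g_root_space (p : bool) (a : hatd) (y : g) : Prop :=
  exists x, [/\ rd_dom x, root_space hatS p a x & pi x = y].

Definition even_positive (a : hatd) : Prop :=
  is_root hatS false a /\ Qplus Sigma a.

(* The simple roots of the even part: the indecomposable even positive roots. *)
Definition even_simple (a : hatd) : Prop :=
  even_positive a /\
  ~ exists b c, [/\ even_positive b, even_positive c & a = b + c].

Definition sl2_triples (Xe Ye He : hatd -> g) : Prop :=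
  forall a, even_positive a ->
    [/\ g_root_space false a (Xe a), g_root_space false (- a) (Ye a) & He a \in h] /\
    [/\ brk S (Xe a) (Ye a) = He a, brk S (He a) (Xe a) = 2%:R *: Xe a &
        brk S (He a) (Ye a) = - (2%:R *: Ye a)].

Definition highest_weight_vector (lam : hdual h) (V : lmodType (Uenv S)) (v : V)
    : Prop :=
  [/\ v != 0, forall x, nplus x -> ugen S x *: v = 0 &
      forall t : subvs_of h, ugen S (vsval t) *: v = uscal S (lam t) *: v].

Definition irreducible (V : lmodType (Uenv S)) : Prop :=
  (exists v : V, v != 0) /\
  forall N : V -> Prop, N 0 -> (forall r x y, N x -> N y -> N (r *: x + y)) ->
    (forall x, N x -> x = 0) \/ (forall x, N x).

Definition finite_dimensional (V : lmodType (Uenv S)) : Prop :=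
  exists s : seq V, forall v, exists c : nat -> F,
    v = \sum_(i < size s) uscal S (c i) *: s`_i.

(* V(lam) is finite-dimensional. *)
Definition Lambda_plus (lam : hdual h) : Prop :=
  exists (V : lmodType (Uenv S)) (v : V),
    [/\ irreducible V, highest_weight_vector lam v & finite_dimensional V].

(* The left-hand sides of the defining relations of a highest weight module over
   a Lie superalgebra L that contains g through iota. *)
Inductive hw_relation (L : lmodType F) (SL : lie_super L) (iota : g -> L)
    (N : L -> Prop) (lam : hdual h) (Ye He : hatd -> g) : Uenv SL -> Prop :=
| hw_relation_nil x : N x -> hw_relation iota N lam Ye He (ugen SL x)
| hw_relation_cartan (t : subvs_of h) :
    hw_relation iota N lam Ye He (ugen SL (iota (vsval t)) - uscal SL (lam t))
| hw_relation_int a k : even_simple a -> lam (vsproj h (He a)) = k%:R ->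
    hw_relation iota N lam Ye He (ugen SL (iota (Ye a)) ^+ k.+1).

Definition Vbar (lam : hdual h) (Ye He : hatd -> g) : lmodType (Uenv S) :=
  @qmod (Uenv S) (Uenv S)^o (hw_relation id nplus lam Ye He).

Definition vbar (lam : hdual h) (Ye He : hatd -> g) : Vbar lam Ye He :=
  @qcl (Uenv S) (Uenv S)^o (hw_relation id nplus lam Ye He) 1.

Variable A : comAlgType F.
Local Notation gA := (current S A).

Definition P_A (V : lmodType (Uenv S)) : lmodType (Uenv gA) :=
  ext_scal (@Uincl F g S A) V.

Definition vlam (lam : hdual h) (Ye He : hatd -> g) : P_A (Vbar lam Ye He) :=
  @pure _ _ (@Uincl F g S A) (Vbar lam Ye He) 1 (vbar lam Ye He).

(* An action of the Cartan subalgebra of rd_hat on a module over g (x) A, which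
   is compatible with its adjoint action and extends that of rd_h.  When rd_hat
   is g, cact_ext says that it is the given action of h, so that weight_space is
   the usual one.  For sl(n,n) and A(n-1,n-1) the weights are those of the Cartan
   subalgebra of gl(n,n), where Sigma lives: restricted to rd_h, Sigma is
   linearly dependent and the cone Q^+ may contain the opposite of a simple
   root. *)
Record cartan_action (V : lmodType (Uenv gA)) (T : subvs_of hath -> V -> V)
    : Prop := {
  cact_lin : forall t c v w,
    T t (uscal gA c *: v + w) = uscal gA c *: T t v + T t w;
  cact_linl : forall c t u v, T (c *: t + u) v = uscal gA c *: T t v + T u v;
  cact_lie : forall t u v,
    T (vsproj hath (brk hatS (vsval t) (vsval u))) v = T t (T u v) - T u (T t v);
  cact_brk : forall t x a v, rd_dom x ->
    T t (ugen gA (ten (pi x) a) *: v) =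
    ugen gA (ten (pi (brk hatS (vsval t) x)) a) *: v +
    ugen gA (ten (pi x) a) *: T t v;
  cact_ext : forall t v, rd_dom (vsval t) ->
    T t v = ugen gA (ten (pi (vsval t)) 1) *: v
}.

Definition weight_space (V : lmodType (Uenv gA)) (T : subvs_of hath -> V -> V)
    (mu : hatd) (v : V) : Prop :=
  forall t, T t v = uscal gA (mu t) *: v.

(* The quotient of V by the submodule generated by the weight spaces V_mu with
   mu not in nu - Q^+. *)
Definition outside (V : lmodType (Uenv gA)) (T : subvs_of hath -> V -> V)
    (nu : hatd) (v : V) : Prop :=
  exists mu, ~ Qplus Sigma (nu - mu) /\ weight_space T mu v.

Definition weight_quotient (V : lmodType (Uenv gA)) (T : subvs_of hath -> V -> V)
    (nu : hatd) : lmodType (Uenv gA) := qmod (outside T nu).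

End Weyl.

Definition has_presentation (U : pzRingType) (W : lmodType U) (w : W)
    (rel : U -> Prop) : Prop :=
  exists phi : {linear @qmod U U^o rel -> W},
    bijective phi /\ phi (@qcl U U^o rel 1) = w.

(* Main.v *)
Require Import Defs.
From HB Require Import structures.
From mathcomp Require Import all_boot all_order all_algebra.
From mathcomp Require Import boolp reals complex.

Set Implicit Arguments.
Unset Strict Implicit.
Unset Printing Implicit Defensive.

Import GRing.Theory.
Local Open Scope ring_scope.

(** Let [v] be the generator of P_A(Vbar) and [N] the submodule generated by the
    (n+ (x) A) v. The relations of Vbar at [v] together with those that define
    [N] are the relations of the proposition, so P_A(Vbar)/N is the module that
    they present: P_A(Vbar) is induced, hence maps to that module
    ([Vbar_map_balanced], [P_A_map]), and conversely the relations hold in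
    the quotient ([presentation_retract]). The content of the proposition is
    that [N] equals the submodule generated by the weight spaces with weights
    outside [lamhat - Q+].

    One inclusion ([raised_outside]) is a matter of weights: n+ is spanned by
    iterated brackets of simple root vectors, which raise the weight [lamhat] by
    a nonzero element of Q+, and the opposite of such an element is not in Q+
    because the simple roots are free and the characteristic is zero
    ([positive_word_weight]).

    For the other inclusion ([outside_raised]), write the Lie superalgebra as
    the sum of the opposite Borel subalgebra b- and of n+. Moving n+ (x) A to the
    right until it meets [v] shows that, modulo [N], the module is spanned by
    products of elements of b- (x) A applied to [v] ([lower_span_full]), so that
    every vector is modulo [N] a sum of weight vectors with weights in
    [lamhat - Q+] ([lower_span_low_sum]). Since [N] is stable under the Cartan
    subalgebra ([raised_stable]), weights can be separated modulo [N], and a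
    vector of a weight outside the cone must lie in [N] ([low_sum_separate]).

    The decomposition b- + n+ ([admissible_triangular]) comes from the ideal
    n- + h' + n+, with h' spanned by the coroots ([derived_ideal]). It requires
    the Cartan subalgebra to be abelian, which follows from its nilpotency and
    the absence of central commutators ([cartan_abelian]). For sl(n,n) and its
    quotient, one works in gl(n,n), whose brackets lie in this ideal and span
    sl(n,n) ([commutator_derived], [sl_perfect]). *)

(** * Spans and iterated brackets *)

Section Spans.
Variable (R : pzRingType).

Lemma submod_gen_mem (M : lmodType R) (X : M -> Prop) x : X x -> submod_gen X x.
Proof.
move=> Xx; rewrite -[x]scale1r -[_ *: _]addr0.
exact: submod_gen_cons (submod_gen0 X).
Qed.

Lemma linear_fun0 (M M' : lmodType R) (f : M -> M') :
  (forall r x y, f (r *: x + y) = r *: f x + f y) -> f 0 = 0.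
Proof. by move/(_ (-1) 0 0); rewrite scaler0 addr0 scaleN1r addNr. Qed.

Lemma submod_gen_map (M M' : lmodType R) (X : M -> Prop) (Y : M' -> Prop)
    (f : M -> M') :
  (forall r x y, f (r *: x + y) = r *: f x + f y) ->
  (forall x, X x -> submod_gen Y (f x)) ->
  forall x, submod_gen X x -> submod_gen Y (f x).
Proof.
move=> fP XY x; elim=> [|r y z Xy _ IH].
  by rewrite (linear_fun0 fP); apply: submod_gen0.
by rewrite fP; apply: submod_genD => //; apply/submod_genZ/XY.
Qed.

Lemma submod_gen_sub (M : lmodType R) (X Y : M -> Prop) :
  (forall x, X x -> submod_gen Y x) -> forall x, submod_gen X x -> submod_gen Y x.
Proof. by move=> XY; apply: (@submod_gen_map _ _ X Y id). Qed.

End Spans.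

Section Words.
Variables (F : fieldType) (g : vectType F) (S : lie_super g).

(** The sign in the Jacobi identity depends only on the parities of the first
    two entries, so the third one may be split into its components. *)
Lemma brk_jacobi_hom p q x y z : par S p x -> par S q y ->
  brk S x (brk S y z) = brk S (brk S x y) z + sgn F p q *: brk S y (brk S x z).
Proof.
move=> px qy; have [z0 [z1 [p0 p1 ->]]] := par_split S z.
by rewrite !brkDr (brk_jacobi px qy p0) (brk_jacobi px qy p1) scalerDr addrACA.
Qed.

Lemma brk_jacobi_even x y z : par S false x ->
  brk S x (brk S y z) = brk S (brk S x y) z + brk S y (brk S x z).
Proof.
move=> px; have [y0 [y1 [p0 p1 ->]]] := par_split S y.
rewrite !(brkDl, brkDr) (brk_jacobi_hom _ px p0) (brk_jacobi_hom _ px p1).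
by rewrite /sgn !expr0 !scale1r addrACA.
Qed.

Lemma brk_anti_even p x y : par S false x -> par S p y ->
  brk S y x = - brk S x y.
Proof. by move=> px py; rewrite (brk_anti py px) /sgn andbF expr0 scale1r. Qed.

(** Subalgebras generated by homogeneous root vectors are studied through these
    iterated brackets: unlike a general element of [gen_alg], each of them is
    again homogeneous and has a weight, so the signed Jacobi identity applies. *)
Inductive bracket_word (X : g -> Prop) : g -> Prop :=
| word_gen x : X x -> bracket_word X x
| word_brk x y : bracket_word X x -> bracket_word X y ->
    bracket_word X (brk S x y).

Lemma span_brk (X Y Z : g -> Prop) :
  (forall x y, X x -> Y y -> submod_gen Z (brk S x y)) ->
  forall x y, submod_gen X x -> submod_gen Y y -> submod_gen Z (brk S x y).
Proof.
move=> XYZ x y Xx Yy.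
apply: (submod_gen_map (X := X) (f := (brk S)^~ y)) Xx => [*|{}x Xx].
  exact: brkPl.
apply: (submod_gen_map (X := Y) (f := brk S x)) Yy => [*|{}y]; last exact: XYZ.
exact: brkPr.
Qed.

Lemma gen_alg_words (X : g -> Prop) x :
  gen_alg S X x <-> submod_gen (bracket_word X) x.
Proof.
split; elim=> {x}.
- by move=> x Xx; apply/submod_gen_mem/word_gen.
- exact: submod_gen0.
- by move=> c x y _ IHx _ IHy; apply: submod_genD => //; apply: submod_genZ.
- move=> x y _ IHx _ IHy; apply: span_brk IHx IHy => u v Xu Xv.
  exact/submod_gen_mem/word_brk.
- exact: gen_alg0.
- move=> c x y Xx _ IHy; apply: gen_alg_lin => //.
  by elim: Xx => [u Xu|u v _ IHu _ IHv]; [exact: gen_alg_mem|exact: gen_alg_brk].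
Qed.

End Words.

Section Weights.
Variables (F : fieldType) (g : vectType F) (S : lie_super g) (h : {vspace g}).
Hypothesis h_even : forall t, t \in h -> par S false t.

Definition weight_vector (a : hdual h) (x : g) := exists p, root_space S p a x.

Lemma root_space_brk p q (a b : hdual h) x y :
  root_space S p a x -> root_space S q b y ->
  root_space S (p (+) q) (a + b) (brk S x y).
Proof.
move=> [px ax] [qy hy]; split; first exact: par_brk.
move=> t; rewrite brk_jacobi_even; last exact/h_even/subvsP.
by rewrite ax hy brkZl brkZr add_lfunE scalerDl.
Qed.

Lemma weight_vector_brk (a b : hdual h) x y :
  weight_vector a x -> weight_vector b y -> weight_vector (a + b) (brk S x y).
Proof.
by move=> [p ax] [q hy]; exists (p (+) q); apply: root_space_brk.
Qed.

Lemma weight_brk (a : hdual h) x (t : g) : weight_vector a x -> t \in h ->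
  brk S t x = a (vsproj h t) *: x.
Proof. by move=> [p [_ ax]] th; rewrite -ax vsprojK. Qed.

Lemma weight_brkr (a : hdual h) x (t : g) : weight_vector a x -> t \in h ->
  brk S x t = - a (vsproj h t) *: x.
Proof.
move=> ax th; have [p [px _]] := ax.
by rewrite (brk_anti_even (h_even th) px) (weight_brk ax th) scaleNr.
Qed.

(** [P] is the set of weights allowed for the generators: the positive ones, the
    negative ones, or all of them. *)
Lemma bracket_word_weight (X : g -> Prop) (P : hdual h -> Prop) :
  (forall a b, P a -> P b -> P (a + b)) ->
  (forall x, X x -> exists2 a, P a & weight_vector a x) ->
  forall x, bracket_word S X x -> exists2 a, P a & weight_vector a x.
Proof.
move=> PD PX x; elim=> {x} [//|x y _ [a Pa ax] _ [b Pb yb]].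
by exists (a + b); [exact: PD|exact: weight_vector_brk].
Qed.

End Weights.

(** * Ideals and the Cartan subalgebra of a simple system *)

Section SimpleSystem.
Variables (F : fieldType) (g : vectType F) (S : lie_super g) (h : {vspace g}).
Variables (Sigma : seq (hdual h)) (X Y : hdual h -> g).
Hypotheses (cartan_h : cartan S h) (simpleXY : simple_system S Sigma X Y).

Let h_even t : t \in h -> par S false t := cartan_even cartan_h (t := t).

Lemma simple_root_vectors b : b \in Sigma ->
  [/\ b != 0, weight_vector S b (X b) & weight_vector S (- b) (Y b)].
Proof. by case/(simple_root simpleXY)=> p [[b0 _] Xb Yb]; split=> //; exists p. Qed.

(** A root is a linear form, so it takes the same value on [s u] and [u s]. *)
Lemma commutator_root_vector (a : hdual h) x s u :
  weight_vector S a x -> s \in h -> u \in h -> brk S (brk S s u) x = 0.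
Proof.
move=> ax sh uh.
have E v w : v \in h -> w \in h ->
    brk S v (brk S w x) = (a (vsproj h v) * a (vsproj h w)) *: x.
  move=> vh wh; rewrite (weight_brk ax wh) brkZr (weight_brk ax vh).
  by rewrite scalerA mulrC.
have := brk_jacobi_even u x (h_even sh); rewrite !E // [in RHS]mulrC.
by move/(congr1 (+%R^~ (- ((a (vsproj h s) * a (vsproj h u)) *: x))));
  rewrite subrr addrK.
Qed.

Lemma centralizer_gen (P : g -> Prop) z : par S false z ->
  (forall x, P x -> brk S z x = 0) -> forall x, gen_alg S P x -> brk S z x = 0.
Proof.
move=> pz zP x; elim=> {x} [x /zP //||c x y _ IHx _ IHy|x y _ IHx _ IHy].
- exact: brk0r.
- by rewrite brkPr IHx IHy scaler0 addr0.
- by rewrite brk_jacobi_even // IHx IHy brk0l brk0r addr0.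
Qed.

(** A Cartan subalgebra is only assumed nilpotent. If it were not abelian, its
    last nonzero iterated bracket would commute with it, and would kill all the
    root vectors because it is a commutator; as these generate, it would be
    central. So a Cartan subalgebra is abelian as soon as no nonzero commutator
    is central. *)
Lemma cartan_abelian :
  (forall s u, s \in h -> u \in h ->
    (forall x, brk S (brk S s u) x = 0) -> brk S s u = 0) ->
  forall s u, s \in h -> u \in h -> brk S s u = 0.
Proof.
move=> cen0; have [k nilk] := cartan_nilp cartan_h.
have foldr_h s t : {subset s <= h} -> t \in h -> foldr (brk S) t s \in h.
  elim: s => //= x s IH sh th; apply: (cartan_closed cartan_h).
    by apply: sh; rewrite mem_head.
  by apply: IH => // y ys; apply: sh; rewrite in_cons ys orbT.
have nilk1: forall s t, size s = k.+1 -> {subset s <= h} -> t \in h ->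
    foldr (brk S) t s = 0.
  case=> [|x s] t //= [sk] sh th; rewrite nilk ?brk0r // => y ys.
  by apply: sh; rewrite in_cons ys orbT.
(* Descend from brackets with k + 2 entries to brackets with k + 1. *)
elim: k nilk1 {nilk} => [nil1 s u sh uh|k IH nilk].
  by apply: (nil1 [:: s] u) => // y; rewrite inE => /eqP ->.
apply: IH => -[|s s'] t //= [sk] sh th.
have s_h : s \in h by apply: sh; rewrite mem_head.
have s'h : {subset s' <= h} by move=> y ys; apply: sh; rewrite in_cons ys orbT.
have uh := foldr_h _ _ s'h th.
apply: cen0 => // x.
have zh : brk S s (foldr (brk S) t s') \in h by apply: (cartan_closed cartan_h).
apply: (centralizer_gen (h_even zh) _ (simple_gen simpleXY x)) => {}x.
move=> [xh|[b /simple_root_vectors [_ Xb Yb] xE]].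
  rewrite (brk_anti_even (h_even xh) (h_even zh)).
  have -> : brk S x (brk S s (foldr (brk S) t s')) =
            foldr (brk S) t [:: x, s & s'] by [].
  rewrite nilk ?oppr0 //= ?sk // => y; rewrite !inE => /or3P[/eqP->|/eqP->|] //.
  exact: s'h.
by case: xE => ->; [apply: commutator_root_vector Xb _ _|
  apply: commutator_root_vector Yb _ _].
Qed.

(** The coroot has weight zero and is even: it normalizes the Cartan subalgebra,
    which contains its own normalizer. *)
Lemma coroot_mem b : b \in Sigma -> brk S (X b) (Y b) \in h.
Proof.
move=> bS; have [p [_ Xb Yb]] := simple_root simpleXY bS.
have [pH hH] := root_space_brk h_even Xb Yb; rewrite addbb in pH.
apply: (cartan_norm cartan_h) => // t th.
by rewrite -(vsprojK th) hH subrr zero_lfunE scale0r mem0v.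
Qed.

Definition coroot x := exists2 b, b \in Sigma & x = brk S (X b) (Y b).
Definition pos_vector x := exists2 b, b \in Sigma & x = X b.
Definition neg_vector x := exists2 b, b \in Sigma & x = Y b.

Lemma word_weight (W : g -> Prop) x :
  (forall x, W x -> exists a : hdual h, weight_vector S a x) ->
  bracket_word S W x -> exists a : hdual h, weight_vector S a x.
Proof.
move=> WP Wx.
have [||a _ ax] := bracket_word_weight h_even (P := fun=> True) _ _ Wx => //.
  by move=> y /WP[a ay]; exists a.
by exists a.
Qed.

(* The triangular decomposition is symmetric in the two families of root
   vectors; [U] and [V] are the families [X] and [Y], in either order. *)
Section Opposite.
Variables U V : g -> Prop.
Hypothesis U_weight : forall x, U x -> exists a : hdual h, weight_vector S a x.
Hypothesis V_weight : forall x, V x -> exists a : hdual h, weight_vector S a x.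
Hypothesis UV : forall x y, U x -> V y -> submod_gen coroot (brk S x y).

(** Only the derivation property is used: bracketing a word in [V] with a
    vector of [U] contracts one letter to a coroot, and a coroot rescales the
    rest of the word. *)
Lemma opposite_brk x y : U x -> bracket_word S V y ->
  submod_gen (fun z => bracket_word S V z \/ coroot z) (brk S x y).
Proof.
move=> Ux; have [a [p [px _]]] := U_weight Ux.
set VH := fun z => bracket_word S V z \/ coroot z.
have VH_V u z : submod_gen VH u -> bracket_word S V z ->
    submod_gen VH (brk S u z) /\ submod_gen VH (brk S z u).
  move=> uP Vz; have [b bz] := word_weight V_weight Vz.
  have spanz := submod_gen_mem (X := eq^~ z) erefl.
  split.
    apply: span_brk uP spanz => {}u z' + ->; case=> [Vu|[c /coroot_mem ch ->]].
      by apply: submod_gen_mem; left; apply: word_brk.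
    by rewrite (weight_brk bz) //; apply/submod_genZ/submod_gen_mem; left.
  apply: span_brk spanz uP => z' {}u ->; case=> [Vu|[c /coroot_mem ch ->]].
    by apply: submod_gen_mem; left; apply: word_brk.
  by rewrite (weight_brkr h_even bz) //; apply/submod_genZ/submod_gen_mem; left.
elim=> {y} [y Vy|y z Vy IHy Vz IHz].
  by apply: submod_gen_sub (UV Ux Vy) => z Hz; apply: submod_gen_mem; right.
have [b [q [qy _]]] := word_weight V_weight Vy.
rewrite (brk_jacobi_hom _ px qy); apply: submod_genD.
  by have [] := VH_V _ _ IHy Vz.
by apply: submod_genZ; have [] := VH_V _ _ IHz Vy.
Qed.

Lemma opposite_stable x y : U x ->
  bracket_word S V y \/ coroot y \/ bracket_word S U y ->
  submod_gen (fun z => bracket_word S V z \/ coroot z \/ bracket_word S U z)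
    (brk S x y).
Proof.
move=> Ux [Vy|[[b /coroot_mem bh ->]|Uy]].
- apply: submod_gen_sub (opposite_brk Ux Vy) => z [Vz|Hz]; apply: submod_gen_mem.
    by left.
  by right; left.
- have [a ax] := U_weight Ux; rewrite (weight_brkr h_even ax) //.
  by apply/submod_genZ/submod_gen_mem; right; right; apply: word_gen.
- by apply: submod_gen_mem; right; right; apply: word_brk => //; apply: word_gen.
Qed.

End Opposite.

(** These vectors span the subspace n- + h' + n+, where h' is the span of the
    coroots; it turns out to be an ideal that contains all brackets. *)
Definition derived_gen x :=
  bracket_word S neg_vector x \/ coroot x \/ bracket_word S pos_vector x.

Lemma pos_weight x : pos_vector x -> exists a : hdual h, weight_vector S a x.
Proof. by move=> [b /simple_root_vectors[_ Xb _] ->]; exists b. Qed.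

Lemma neg_weight x : neg_vector x -> exists a : hdual h, weight_vector S a x.
Proof. by move=> [b /simple_root_vectors[_ _ Yb] ->]; exists (- b). Qed.

Lemma pos_neg x y : pos_vector x -> neg_vector y -> submod_gen coroot (brk S x y).
Proof.
move=> [b bS ->] [c cS ->]; have [<-|bc] := eqVneq b c.
  by apply: submod_gen_mem; exists b.
by rewrite (simple_orth simpleXY) //; apply: submod_gen0.
Qed.

Lemma neg_pos x y : neg_vector x -> pos_vector y -> submod_gen coroot (brk S x y).
Proof.
move=> Nx Py; have [_ [p [px _]]] := neg_weight Nx.
have [_ [q [qy _]]] := pos_weight Py.
rewrite (brk_anti px qy) -scaleNr; apply/submod_genZ.
exact: pos_neg.
Qed.

Lemma derived_stable_pos x y : pos_vector x -> submod_gen derived_gen y ->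
  submod_gen derived_gen (brk S x y).
Proof.
move=> Px; apply: submod_gen_map => [*|{}y]; first exact: brkPr.
exact: (opposite_stable pos_weight neg_weight pos_neg).
Qed.

Lemma derived_stable_neg x y : neg_vector x -> submod_gen derived_gen y ->
  submod_gen derived_gen (brk S x y).
Proof.
move=> Nx; apply: submod_gen_map => [*|{}y Dy]; first exact: brkPr.
have Dy' : bracket_word S pos_vector y \/ coroot y \/ bracket_word S neg_vector y.
  by case: Dy => [|[]]; auto.
apply: submod_gen_sub (opposite_stable neg_weight pos_weight neg_pos Nx Dy').
by move=> z [|[]] Dz; apply: submod_gen_mem; [right; right|right; left|left].
Qed.

Hypothesis h_abelian : forall s u, s \in h -> u \in h -> brk S s u = 0.

Lemma derived_weight x : derived_gen x -> exists a : hdual h, weight_vector S a x.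
Proof.
case=> [|[[b /coroot_mem bh ->]|]].
- exact: word_weight neg_weight.
- exists 0, false; split; first exact: h_even.
  by move=> t; rewrite h_abelian ?subvsP // zero_lfunE scale0r.
- exact: word_weight pos_weight.
Qed.

Lemma derived_stable_h t y : t \in h -> submod_gen derived_gen y ->
  submod_gen derived_gen (brk S t y).
Proof.
move=> th; apply: submod_gen_map => [*|{}y Dy]; first exact: brkPr.
have [a ay] := derived_weight Dy.
by rewrite (weight_brk ay th); apply/submod_genZ/submod_gen_mem.
Qed.

(** Stability under the generators passes to iterated brackets by the Jacobi
    identity. *)
Lemma derived_ideal x y : submod_gen derived_gen y ->
  submod_gen derived_gen (brk S x y).
Proof.
have: forall u, bracket_word S (fun z => z \in h \/
    exists2 b, b \in Sigma & z = X b \/ z = Y b) u -> (exists p, par S p u) /\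
  forall y, submod_gen derived_gen y -> submod_gen derived_gen (brk S u y).
  move=> u; elim=> {u} [u [uh|[b bS [uE|uE]]]|u v _ [[p pu] IHu] _ [[q qv] IHv]].
  - by split; [exists false; apply: h_even|move=> z; apply: derived_stable_h].
  - have Pu : pos_vector u by exists b.
    have [a [p [pu _]]] := pos_weight Pu.
    by split; [exists p|move=> z; apply: derived_stable_pos].
  - have Nu : neg_vector u by exists b.
    have [a [p [pu _]]] := neg_weight Nu.
    by split; [exists p|move=> z; apply: derived_stable_neg].
  - split; first by exists (p (+) q); apply: par_brk.
    move=> z Dz; have /esym/(canRL (addrK _)) -> := brk_jacobi_hom z pu qv.
    apply: submod_genD; first exact/IHu/IHv.
    by apply/submod_genN/submod_genZ/IHv/IHu.
move=> word_stable Dy; have /gen_alg_words := simple_gen simpleXY x.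
apply: (submod_gen_map (f := (brk S)^~ y)) => [*|u /word_stable[_]]; last exact.
exact: brkPl.
Qed.

Lemma derived_idealr x y : submod_gen derived_gen x ->
  submod_gen derived_gen (brk S x y).
Proof.
elim=> [|c u v Du _ IH]; first by rewrite brk0l; apply: submod_gen0.
rewrite brkPl; apply: submod_genD IH; apply: submod_genZ.
have [a [p [pu _]]] := derived_weight Du.
have [y0 [y1 [p0 p1 ->]]] := par_split S y.
rewrite brkDr (brk_anti pu p0) (brk_anti pu p1) -!scaleNr.
by apply: submod_genD; apply/submod_genZ/derived_ideal/submod_gen_mem.
Qed.

Lemma derived_plus_cartan x :
  exists2 t, t \in h & submod_gen derived_gen (x - t).
Proof.
elim: (simple_gen simpleXY x) => {x}
    [x [xh|[b bS xE]]||c x y _ [t th Dx] _ [u uh Dy]|x y _ [t th Dx] _ [u uh Dy]].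
- by exists x; rewrite // subrr; apply: submod_gen0.
- exists 0; rewrite ?mem0v // subr0; apply: submod_gen_mem.
  by case: xE => xE; [right; right|left]; apply: word_gen; exists b.
- by exists 0; rewrite ?mem0v // subr0; apply: submod_gen0.
- exists (c *: t + u); first by rewrite memvD ?memvZ.
  rewrite opprD addrACA -scalerBr; apply: submod_genD => //.
  exact: submod_genZ.
- exists 0; rewrite ?mem0v // subr0 -[x in brk S x](subrK t) brkDl.
  apply: submod_genD; first exact: derived_idealr.
  rewrite -[y](subrK u) brkDr (h_abelian th uh) addr0.
  exact: derived_ideal.
Qed.

(** The algebra is the sum of the ideal and of the Cartan subalgebra, which is
    abelian, so the quotient by the ideal is commutative. This matters for
    sl(n,n), whose Cartan subalgebra is by definition spanned by the coroots. *)
Lemma commutator_derived x y : submod_gen derived_gen (brk S x y).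
Proof.
have [t th Dx] := derived_plus_cartan x; have [u uh Dy] := derived_plus_cartan y.
rewrite -[x in brk S x](subrK t) brkDl.
apply: submod_genD; first exact: derived_idealr.
by rewrite -[y](subrK u) brkDr (h_abelian th uh) addr0; apply: derived_ideal.
Qed.

Hypothesis char0 : [pchar F] =i pred0.

Lemma QplusD a b : Qplus Sigma a -> Qplus Sigma b -> Qplus Sigma (a + b).
Proof.
move=> [c ->] [d ->]; exists (fun x => (c x + d x)%N).
by rewrite -big_split; apply: eq_bigr => x _; rewrite mulrnDr.
Qed.

Lemma Qplus0 : Qplus Sigma 0.
Proof. by exists (fun=> 0%N); rewrite big1. Qed.

Lemma Qplus_simple b : b \in Sigma -> Qplus Sigma b.
Proof.
move=> bS; exists (fun x => (x == b) : nat).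
rewrite (bigD1_seq b) ?(free_uniq (simple_free simpleXY)) //= eqxx.
by rewrite big1 ?addr0 // => x /negPf ->.
Qed.

(** This is where characteristic zero enters: a vanishing combination of the
    free family [Sigma] with coefficients in the image of the naturals has all
    of them equal to zero, while the coefficient of [b] below is a successor. *)
Lemma Qplus_simpleN b : b \in Sigma -> ~ Qplus Sigma (- b).
Proof.
move=> bS [c bE]; pose d x := ((x == b) + c x)%N.
have d0 : \sum_(x <- Sigma) (d x)%:R *: x = 0.
  transitivity (b + \sum_(x <- Sigma) x *+ c x); last by rewrite -bE subrr.
  transitivity (\sum_(x <- Sigma) (x *+ (x == b) + x *+ c x)).
    by apply: eq_bigr => x _; rewrite scaler_nat mulrnDr.
  rewrite big_split /=; congr (_ + _).
  rewrite (bigD1_seq b) ?(free_uniq (simple_free simpleXY)) //= eqxx.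
  by rewrite big1 ?addr0 // => x /negPf ->.
have [k _ kuniq] := free_span (simple_free simpleXY) (mem0v <<Sigma>>%VS).
have k0 : k b = 0 by rewrite -(kuniq (fun=> 0)) // big1 // => x _; rewrite scale0r.
have := kuniq (fun x => (d x)%:R) (esym d0) b bS; rewrite k0 /d eqxx add1n.
by move/eqP; rewrite (proj1 (pcharf0P F) char0).
Qed.

(** The property [~ Qplus Sigma (- a)] passes from [a] to [a + b] for [b] in Q+,
    so freeness is needed only for the simple roots. It is what moves the weight
    of a raised vector outside the cone. *)
Lemma positive_word_weight x : bracket_word S pos_vector x ->
  exists2 a, Qplus Sigma a /\ ~ Qplus Sigma (- a) & weight_vector S a x.
Proof.
apply: bracket_word_weight => // [a b [Qa Na] [Qb _]|{}x [b bS ->]].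
  split; first exact: QplusD.
  by move=> Nab; apply: Na; rewrite -(subrK b (- a)) -opprD; apply: QplusD.
exists b; last by have [_ ? _] := simple_root_vectors bS.
by split; [apply: Qplus_simple|apply: Qplus_simpleN].
Qed.

Lemma negative_word_weight x : bracket_word S neg_vector x ->
  exists2 a, Qplus Sigma (- a) & weight_vector S a x.
Proof.
apply: bracket_word_weight => // [a b|{}x [b bS ->]].
  by rewrite opprD; apply: QplusD.
exists (- b); last by have [_ _ ?] := simple_root_vectors bS.
by rewrite opprK; apply: Qplus_simple.
Qed.

End SimpleSystem.

(** * The general linear superalgebra *)

Section GeneralLinear.
Variables (F : fieldType) (n : nat).
Local Notation M2 := 'M[F]_(n + n).

(** The parity of a coordinate; the matrix unit at (i, j) has parity
    [ipar i (+) ipar j]. *)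
Definition ipar (i : 'I_(n + n)) : bool := (n <= i)%N.

Lemma ipar_lshift (i : 'I_n) : ipar (lshift n i) = false.
Proof. by rewrite /ipar /= leqNgt ltn_ord. Qed.

Lemma ipar_rshift (i : 'I_n) : ipar (rshift n i) = true.
Proof. by rewrite /ipar /= leq_addr. Qed.

Lemma mxpartE p (x : M2) i j :
  mxpart p x i j = if p == ipar i (+) ipar j then x i j else 0.
Proof.
case: (split_ordP i) => {}i ->; case: (split_ordP j) => {}j ->;
  rewrite ?ipar_lshift ?ipar_rshift; case: p;
  rewrite /mxpart ?block_mxEul ?block_mxEur ?block_mxEdl ?block_mxEdr;
  by rewrite ?mxE.
Qed.

Lemma gl_par_delta i j : gl_par (ipar i (+) ipar j) (delta_mx i j : M2).
Proof.
apply/matrixP => k l; rewrite mxpartE !mxE.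
by case: (k =P i) => [->|_]; case: (l =P j) => [->|_]; rewrite ?eqxx // ?if_same.
Qed.

Lemma strE (x : M2) : str x = \sum_i (-1) ^+ ipar i * x i i.
Proof.
rewrite big_split_ord /str /mxtrace -sumrN; congr (_ + _); apply: eq_bigr => i _.
  by rewrite ipar_lshift mul1r !mxE.
by rewrite ipar_rshift mulN1r !mxE.
Qed.

Lemma str_is_linear c (x y : M2) : str (c *: x + y) = c * str x + str y.
Proof.
rewrite !strE mulr_sumr -big_split; apply: eq_bigr => i _ /=.
by rewrite !mxE mulrDr mulrCA.
Qed.

Lemma str_mul p q (x y : M2) : gl_par p x -> gl_par q y ->
  str (x *m y) = sgn F p q * str (y *m x).
Proof.
rewrite /gl_par => <- <-.
rewrite /str -[x]submxK -[y]submxK /mxpart.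
rewrite !(block_mxKul, block_mxKur, block_mxKdl, block_mxKdr).
by case: p; case: q; rewrite !mulmx_block
   !(block_mxKul, block_mxKur, block_mxKdl, block_mxKdr)
   !(mul0mx, mulmx0, addr0, add0r) ?linear0 /sgn /= ?subrr ?mulr0 ?expr0 ?mul1r
   ?expr1 ?mulN1r ?opprB //;
  congr (_ - _); apply: mxtrace_mulC.
Qed.

Lemma str_brk (x y : M2) : str (gl_brk x y) = 0.
Proof.
have str_sum I (r : seq I) (G : I -> M2) :
    str (\sum_(i <- r) G i) = \sum_(i <- r) str (G i).
  elim: r => [|i r IH]; last first.
    by rewrite !big_cons -[G i]scale1r str_is_linear mul1r IH scale1r.
  rewrite !big_nil; have := str_is_linear (-1) 0 0.
  by rewrite scaler0 addr0 mulN1r addNr.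
rewrite /gl_brk str_sum big1 // => p _; rewrite str_sum big1 // => q _.
have parK r (z : M2) : gl_par r (mxpart r z) by rewrite /gl_par mxpartK eqxx.
by rewrite addrC -scaleNr str_is_linear (str_mul (parK p x) (parK q y)) mulNr addNr.
Qed.

Lemma gl_brk_delta i j : gl_brk (delta_mx i j : M2) (delta_mx j i) =
  delta_mx i i - (-1) ^+ (ipar i (+) ipar j) *: delta_mx j j.
Proof.
rewrite (gl_brkE (gl_par_delta i j) (gl_par_delta j i)) !mul_delta_mx.
by rewrite /sgn [ipar j (+) _]addbC andbb.
Qed.

Lemma gl_brk_delta_offdiag i j : i != j ->
  gl_brk (delta_mx i i : M2) (delta_mx i j) = delta_mx i j.
Proof.
move=> ij; rewrite (gl_brkE (gl_par_delta i i) (gl_par_delta i j)).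
by rewrite mul_delta_mx mul_delta_mx_0 ?scaler0 ?subr0 // eq_sym.
Qed.

(** Off-diagonal matrix units are brackets with diagonal ones. On the diagonal,
    the bracket of the units at (i, k) and (k, i) turns the unit at (i, i) into
    plus or minus the unit at (k, k), for one fixed k; the total coefficient of
    the latter is the supertrace, up to a sign. *)
Lemma sl_perfect (x : M2) : str x = 0 ->
  submod_gen (fun z => exists u v : M2, z = gl_brk u v) x.
Proof.
set D := submod_gen _ => x0.
have Dsum I (r : seq I) (P : pred I) (G : I -> M2) :
    (forall i, P i -> D (G i)) -> D (\sum_(i <- r | P i) G i).
  by move=> DG; elim/big_rec: _ => [|i y Pi Dy]; [apply: submod_gen0|
     apply: submod_genD => //; apply: DG].
have [k _|no_index] := pickP (fun _ : 'I_(n + n) => true); last first.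
  have -> : x = 0 by apply/matrixP => i; have := no_index i.
  exact: submod_gen0.
pose s i : F := (-1) ^+ (ipar i (+) ipar k).
have -> : x = \sum_i \sum_j (x i j *: delta_mx i j -
                (x i i * s i) *+ (i == j) *: delta_mx k k).
  under eq_bigr => i _ do rewrite sumrB.
  rewrite sumrB -matrix_sum_delta.
  under [X in _ - X]eq_bigr => i _.
    rewrite -scaler_suml (bigD1 i) //= eqxx big1 => [|j /negPf]; last first.
      by rewrite eq_sym => ->.
    rewrite addr0 /s signr_addb mulrA [x i i * _]mulrC.
  over.
  by rewrite -scaler_suml -mulr_suml -strE x0 mul0r scale0r subr0.
apply: (Dsum) => i _; apply: Dsum => j _.
have [<-|ij] := eqVneq i j; last first.
  rewrite mulr0n scale0r subr0; apply/submod_genZ/submod_gen_mem.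
  by exists (delta_mx i i), (delta_mx i j); rewrite gl_brk_delta_offdiag.
rewrite mulr1n -scalerA -scalerBr -gl_brk_delta; apply/submod_genZ/submod_gen_mem.
by exists (delta_mx i k), (delta_mx k i).
Qed.

(** A central element is a scalar matrix, and a commutator of even elements has
    trace zero on the upper left block, so the scalar is zero. *)
Lemma gl_center_commutator (z s u : M2) : [pchar F] =i pred0 -> (0 < n)%N ->
  gl_par false s -> gl_par false u -> z = gl_brk s u ->
  (forall x, gl_brk z x = 0) -> z = 0.
Proof.
move=> char0 n0 ps pu zE zc.
have pz : gl_par false z by rewrite zE; apply: (gl_par_brk ps pu).
have comm i j : z *m delta_mx i j = delta_mx i j *m z.
  apply/eqP; rewrite -subr_eq0; apply/eqP.
  by rewrite -(zc (delta_mx i j)) (gl_brkE pz (gl_par_delta i j)) /sgn scale1r.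
have zij i j k : z i j = z k k *+ (i == j).
  have := comm j k => /matrixP/(_ i k).
  rewrite !mxE (bigD1 j) //= big1 => [|l /negPf lj]; last first.
    by rewrite mxE lj mulr0.
  rewrite mxE !eqxx mulr1 addr0 => ->.
  rewrite (bigD1 k) //= big1 => [|l /negPf lk]; last by rewrite mxE lk andbF mul0r.
  by rewrite mxE eqxx andbT addr0 mulr_natl.
pose k : 'I_(n + n) := lshift n (Ordinal n0).
have tr0 : \tr (ulsubmx z) = 0.
  rewrite zE (gl_brkE ps pu) /sgn scale1r -ps -pu /mxpart !mulmx_block.
  rewrite opp_block_mx add_block_mx block_mxKul !(mul0mx, mulmx0, addr0).
  by rewrite linearB /= mxtrace_mulC subrr.
have zk : z k k = 0.
  apply/eqP; move/eqP: tr0; rewrite /mxtrace.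
  under eq_bigr => i _ do rewrite !mxE (zij _ _ k) eqxx mulr1n.
  rewrite sumr_const card_ord -mulr_natl mulf_eq0 (proj1 (pcharf0P F) char0).
  by rewrite eqn0Ngt n0.
by apply/matrixP => i j; rewrite (zij i j k) zk mul0rn mxE.
Qed.

End GeneralLinear.

(** * Triangular decomposition of admissible root data *)

(** The line through a central even element is a graded ideal. *)
Lemma simple_center0 (F : fieldType) (g : vectType F) (S : lie_super g) z :
  simple_super S -> par S false z -> (forall x, brk S z x = 0) -> z = 0.
Proof.
move=> [[x [y xy0]] ideals] pz zc.
have zcr u : brk S u z = 0.
  have [u0 [u1 [p0 p1 ->]]] := par_split S u.
  by rewrite brkDl !(brk_anti_even pz p0, brk_anti_even pz p1) !zc oppr0 addr0.
have [|z0|zT] := ideals <[z]>%VS.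
- split=> [u uz|u v /vlineP[c ->]]; last by rewrite brkZr zcr scaler0 mem0v.
  exists u, 0; split; rewrite ?mem0v ?addr0 //; last exact: par0.
  by case/vlineP: uz => c ->; apply: parZ.
- by apply/eqP; rewrite -memv0 -z0 memv_line.
- have /vlineP[c xE] : x \in <[z]>%VS by rewrite zT memvf.
  by case/eqP: xy0; rewrite xE brkZl zc scaler0.
Qed.

Section RootDatum.
Variables (F : fieldType) (G : root_datum F).
Local Notation hatS := (rd_hatS G).
Local Notation Sigma := (rd_Sigma G).
Local Notation S := (rd_S G).
Local Notation pi := (rd_pi G).
Local Notation hatd := (hdual (rd_cartan G)).

(** Weight zero is allowed, so that lower vectors span the opposite Borel
    subalgebra n- + h and not just n-. *)
Definition lower (y : rd_g G) :=
  exists2 a : hatd, Qplus Sigma (- a) & exists p, g_root_space p a y.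

Definition raising (y : rd_g G) := exists2 b, b \in Sigma & y = pi (rd_X b).

(** What the weight argument needs to know about the root datum. The field
    [tri_decomp] says that the Lie superalgebra is the sum of its opposite Borel
    subalgebra and of n+. *)
Record triangular : Prop := {
  tri_cartan : cartan hatS (rd_cartan G);
  tri_simple : simple_system hatS Sigma (@rd_X F G) (@rd_Y F G);
  tri_dom_brk : forall x y, rd_dom (brk hatS x y);
  tri_par : forall p x, rd_dom x -> par hatS p x -> par S p (pi x);
  tri_brk : forall x y, rd_dom x -> rd_dom y ->
    pi (brk hatS x y) = brk S (pi x) (pi y);
  tri_onto : forall y, exists2 x, rd_dom x & pi x = y;
  tri_decomp : forall y,
    submod_gen (fun z => lower z \/ bracket_word S raising z) y
}.

Hypotheses (cartan_h : cartan hatS (rd_cartan G))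
  (simpleXY : simple_system hatS Sigma (@rd_X F G) (@rd_Y F G))
  (dom_brk : forall x y, rd_dom (brk hatS x y))
  (pi_brk : forall x y, rd_dom x -> rd_dom y ->
    pi (brk hatS x y) = brk S (pi x) (pi y)).

Let h_even t : t \in rd_cartan G -> par hatS false t := cartan_even cartan_h (t := t).

(** A root vector is a multiple of its bracket with an element of the Cartan
    subalgebra, and brackets lie in the domain. *)
Lemma weight_vector_dom (a : hatd) x :
  a != 0 -> weight_vector hatS a x -> rd_dom x.
Proof.
move=> a0 [p [_ ax]]; have [t at0] : exists t, a t != 0.
  apply: contrapT => a_0; case/eqP: a0; apply/lfunP => t.
  by rewrite zero_lfunE; apply/eqP/negPn/negP => at0; apply: a_0; exists t.
have -> : x = brk hatS (vsval t) ((a t)^-1 *: x).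
  by rewrite brkZr ax scalerA mulVf ?scale1r.
exact: dom_brk.
Qed.

Lemma word_dom (P : rd_hat G -> Prop) x : (forall y, P y -> rd_dom y) ->
  bracket_word hatS P x -> rd_dom x.
Proof. by move=> Pdom; case=> [y /Pdom|y z _ _]. Qed.

Lemma pos_vector_dom x : pos_vector Sigma (@rd_X F G) x -> rd_dom x.
Proof.
move=> [b /(simple_root_vectors simpleXY)[b0 Xb _] ->]; exact: weight_vector_dom Xb.
Qed.

Lemma neg_vector_dom x : neg_vector Sigma (@rd_Y F G) x -> rd_dom x.
Proof.
move=> [b /(simple_root_vectors simpleXY)[b0 _ Yb] ->].
by apply: weight_vector_dom Yb; rewrite oppr_eq0.
Qed.

Lemma raising_word_pi x : bracket_word hatS (pos_vector Sigma (@rd_X F G)) x ->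
  bracket_word S raising (pi x).
Proof.
elim=> {x} [x [b bS ->]|x y Wx IHx Wy IHy]; first by apply: word_gen; exists b.
by rewrite pi_brk; [apply: word_brk|exact: word_dom pos_vector_dom Wx|
  exact: word_dom pos_vector_dom Wy].
Qed.

Lemma raising_word_lift y : bracket_word S raising y ->
  exists2 x, bracket_word hatS (pos_vector Sigma (@rd_X F G)) x & pi x = y.
Proof.
elim=> {y} [y [b bS ->]|y y' _ [x Wx <-] _ [x' Wx' <-]].
  by exists (rd_X b) => //; apply: word_gen; exists b.
exists (brk hatS x x'); first exact: word_brk.
by rewrite pi_brk //; [exact: word_dom pos_vector_dom Wx|exact: word_dom pos_vector_dom Wx'].
Qed.

Lemma derived_lower_or_raising x :
  (forall s u, s \in rd_cartan G -> u \in rd_cartan G -> brk hatS s u = 0) ->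
  derived_gen hatS Sigma (@rd_X F G) (@rd_Y F G) x ->
  lower (pi x) \/ bracket_word S raising (pi x).
Proof.
move=> h_abelian; case=> [Wx|[[b bS ->]|/raising_word_pi]]; [left|left|by right].
- have [a Qa [p ax]] := negative_word_weight cartan_h simpleXY Wx.
  by exists a => //; exists p, x; split=> //; apply: word_dom neg_vector_dom Wx.
- exists 0; first by rewrite oppr0; apply: Qplus0.
  exists false, (brk hatS (rd_X b) (rd_Y b)); split=> //.
  have bh := coroot_mem cartan_h simpleXY bS; split; first exact: h_even.
  by move=> t; rewrite h_abelian ?subvsP // zero_lfunE scale0r.
Qed.

End RootDatum.

(** When the Lie superalgebra is basic, it is simple, hence has no center, and
    its Cartan subalgebra is abelian, so of weight zero. When it comes from
    gl(n,n), the Cartan subalgebra of gl(n,n) leaves sl(n,n), but sl(n,n) is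
    spanned by brackets of gl(n,n), and these lie in n- + h' + n+. *)
Lemma admissible_triangular (F : fieldType) (G : root_datum F) :
  [pchar F] =i pred0 -> admissible G -> triangular G.
Proof.
move=> char0; case=> {G}.
  move=> g S h Sigma X Y [simple_S _ _] _ cartan_h simpleXY.
  have h_even t : t \in h -> par S false t := cartan_even cartan_h (t := t).
  have h_abelian : forall s u, s \in h -> u \in h -> brk S s u = 0.
    apply: cartan_abelian cartan_h simpleXY _ => s u sh uh; apply: simple_center0 => //.
    by rewrite -[false]/(addb false false); apply: par_brk; apply: h_even.
  split=> //= y; first by exists y.
  set G := RootDatum _ _ _ _ _ _ _ _.
  have [t th Dy] := derived_plus_cartan cartan_h simpleXY h_abelian y.
  rewrite -(subrK t y) -[_ - t]/(rd_pi G (y - t)); apply: submod_genD.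
    move: Dy; apply: (submod_gen_map (f := rd_pi G)) => [//|x Dx].
    by apply/submod_gen_mem/derived_lower_or_raising.
  apply: submod_gen_mem; left; exists 0; first by rewrite oppr0; apply: Qplus0.
  exists false, t; split=> //; split; first exact: h_even.
  by move=> u; rewrite h_abelian ?subvsP // zero_lfunE scale0r.
move=> n h Sigma X Y g S pi n1 slpi cartan_h simpleXY.
have [pi_par pi_brk pi_onto] : [/\
    forall p x, str x = 0 -> gl_par p x -> par S p (pi x),
    forall x y, str x = 0 -> str y = 0 -> pi (gl_brk x y) = brk S (pi x) (pi y) &
    forall y, exists2 x, str x = 0 & pi x = y].
  by case: slpi => [] [].
have h_even t : t \in h -> gl_par false t := cartan_even cartan_h (t := t).
have h_abelian : forall s u, s \in h -> u \in h -> gl_brk s u = 0.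
  apply: (cartan_abelian cartan_h simpleXY) => s u sh uh.
  apply: gl_center_commutator => //; [exact: ltnW|exact: h_even|exact: h_even].
split=> //= [x y|y]; first exact: str_brk.
have [x x0 <-] := pi_onto y.
have := sl_perfect x0; apply: (submod_gen_map (f := pi)) => [*|_ [u [v ->]]].
  exact: linearP.
have := commutator_derived cartan_h simpleXY h_abelian u v.
apply: (submod_gen_map (f := pi)) => [*|z Dz]; first exact: linearP.
set G := RootDatum _ _ _ _ _ _ _ _.
apply: submod_gen_mem; apply: (@derived_lower_or_raising F G) => //.
exact: str_brk.
Qed.

(** * Weights of a cyclic module over the current superalgebra *)

Section UenvLinearity.
Variables (F : fieldType) (L : lmodType F) (SL : lie_super L).

Lemma uscalN1 : uscal SL (-1) = -1.
Proof. by apply/eqP; rewrite -subr_eq0 opprK -[X in _ + X]/(uscal SL 1) -uscalD addNr. Qed.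

Lemma ugen0 : ugen SL 0 = 0.
Proof.
have := ugenP SL (-1) 0 0; rewrite scaler0 addr0 uscalN1 => ->.
by rewrite mulN1r addNr.
Qed.

Lemma ugenD x y : ugen SL (x + y) = ugen SL x + ugen SL y.
Proof. by rewrite -[x in LHS]scale1r ugenP -[uscal SL 1]/(1 : Uenv SL) mul1r. Qed.

Lemma ugenZ c x : ugen SL (c *: x) = uscal SL c * ugen SL x.
Proof. by rewrite -[_ *: _]addr0 ugenP ugen0 addr0. Qed.

Lemma uscalB c d : uscal SL (c - d) = uscal SL c - uscal SL d.
Proof. by rewrite uscalD -[- d]mulN1r uscalM uscalN1 mulN1r. Qed.

End UenvLinearity.

Section WeightArgument.
Variables (F : fieldType) (G : root_datum F) (A : comAlgType F).
Local Notation S := (rd_S G).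
Local Notation gA := (current S A).
Local Notation pi := (rd_pi G).
Local Notation hatd := (hdual (rd_cartan G)).
Local Notation Sigma := (rd_Sigma G).
Variables (V : lmodType (Uenv gA)) (T : subvs_of (rd_cartan G) -> V -> V).
Hypotheses (triG : triangular G) (char0 : [pchar F] =i pred0).
Hypothesis T_action : cartan_action T.

Lemma cartan_actD t v w : T t (v + w) = T t v + T t w.
Proof.
by have := cact_lin T_action t 1 v w; rewrite -[uscal gA 1]/(1 : Uenv gA) !scale1r.
Qed.

Lemma cartan_act0 t : T t 0 = 0.
Proof.
by have := cact_lin T_action t (-1) 0 0; rewrite scaler0 addr0 uscalN1 scaleN1r addNr.
Qed.

Lemma cartan_actZ t c v : T t (uscal gA c *: v) = uscal gA c *: T t v.
Proof. by rewrite -[uscal gA c *: v]addr0 (cact_lin T_action) cartan_act0 addr0. Qed.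

Lemma weight_scale mu c v : weight_space T mu v -> weight_space T mu (uscal gA c *: v).
Proof. by move=> vmu t; rewrite cartan_actZ vmu !scalerA uscalC. Qed.

Lemma weight_act p (a mu : hatd) y c v :
  g_root_space p a y -> weight_space T mu v ->
  weight_space T (mu + a) (ugen gA (ten y c) *: v).
Proof.
move=> [x [dx [_ ax] <-]] vmu t; rewrite (cact_brk T_action) // ax linearZ /=.
rewrite tenZl ugenZ vmu !scalerA -uscalC -scalerDl -mulrDl.
by rewrite -uscalD add_lfunE addrC.
Qed.

Variables (lamhat : hatd) (v0 : V).
Hypotheses (v0_weight : weight_space T lamhat v0)
  (v0_gen : forall v, exists r, v = r *: v0).

(** Here [v0] is a cyclic weight vector of [V], and [N] is the submodule that the
    relations for n+ generate. It will turn out to be the submodule generated by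
    the weight spaces outside the cone. *)
Definition raised (v : V) :=
  exists2 x, sub_ten (@nplus F G) x & v = ugen gA x *: v0.

Local Notation N := (submod_gen raised).

Lemma raised_ten y c : nplus y -> N (ugen gA (ten y c) *: v0).
Proof.
move=> ny; apply: submod_gen_mem; exists (ten y c) => //.
by rewrite -[ten y c]addr0; apply: sub_ten_cons => //; apply: sub_ten0.
Qed.

Lemma raising_word_root y : bracket_word S (@raising F G) y ->
  exists2 a : hatd, Qplus Sigma a /\ ~ Qplus Sigma (- a) &
    exists p, g_root_space p a y.
Proof.
have [cartan_h simpleXY dom_brk _ pi_brk _ _] := triG.
move=> /(raising_word_lift simpleXY dom_brk pi_brk)[x Wx <-].
have [a Qa [p ax]] := positive_word_weight cartan_h simpleXY char0 Wx.
exists a => //; exists p, x; split=> //.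
exact (word_dom dom_brk (pos_vector_dom simpleXY dom_brk) Wx).
Qed.

Lemma nplus_words y : nplus y <-> submod_gen (bracket_word S (@raising F G)) y.
Proof. exact: gen_alg_words. Qed.

Lemma raised_outside v : raised v -> submod_gen (outside T lamhat) v.
Proof.
case=> x nx ->; elim: nx => [|y c u /nplus_words ny _ IH].
  by rewrite ugen0 scale0r; apply: submod_gen0.
rewrite ugenD scalerDl; apply: submod_genD => //.
elim: ny => [|d z y' Wz _ IHy]; first by rewrite ten0l ugen0 scale0r; apply: submod_gen0.
rewrite tenPl ugenP scalerDl; apply: submod_genD => //.
rewrite -scalerA; apply/submod_genZ/submod_gen_mem.
have [a [_ Na] [p az]] := raising_word_root Wz.
exists (lamhat + a); split; last exact: weight_act az v0_weight.
by rewrite opprD addrA subrr add0r.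
Qed.

(** The operators of [T] act on the current superalgebra by derivations, so
    stability of [N] need only be tested on generators. *)
Lemma stable_submod v : N v -> (forall t, N (T t v)) ->
  forall r t, N (T t (r *: v)).
Proof.
have [_ _ dom_brk _ _ onto _] := triG.
move=> Nv NTv r; elim/uclP: r => a; elim: a v Nv NTv
    => [x|c|a IHa b IHb|a IHa b IHb] v Nv NTv t.
- rewrite -[ucl gA _]/(ugen gA x); elim/gten_ind: x => [|y c u IH].
    by rewrite ugen0 scale0r cartan_act0; apply: submod_gen0.
  rewrite ugenD scalerDl cartan_actD; apply: submod_genD => //.
  have [x dx <-] := onto y; rewrite (cact_brk T_action) //.
  by apply: submod_genD; apply: submod_genZ.
- by rewrite cartan_actZ; apply: submod_genZ.
- by rewrite uclD scalerDl cartan_actD; apply: submod_genD; [apply: IHa|apply: IHb].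
- rewrite uclM -scalerA; apply: IHa; first exact: submod_genZ.
  exact: IHb.
Qed.

Lemma raised_stable t v : N v -> N (T t v).
Proof.
elim=> [|r u w Ru _ IH]; first by rewrite cartan_act0; apply: submod_gen0.
rewrite cartan_actD; apply: submod_genD => //.
apply: stable_submod => {r w IH t}; first exact: submod_gen_mem.
case: Ru => x nx -> t; elim: nx => [|y c z /nplus_words ny _ IH].
  by rewrite ugen0 scale0r cartan_act0; apply: submod_gen0.
rewrite ugenD scalerDl cartan_actD; apply: submod_genD => //.
elim: ny => [|d x1 y' Wx _ IHy].
  by rewrite ten0l ugen0 scale0r cartan_act0; apply: submod_gen0.
rewrite tenPl ugenP scalerDl cartan_actD; apply: submod_genD => //.
rewrite -scalerA cartan_actZ; apply: submod_genZ.
have [a _ [p ax]] := raising_word_root Wx.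
rewrite (weight_act _ ax v0_weight); apply/submod_genZ/raised_ten.
exact/nplus_words/submod_gen_mem.
Qed.

(** The sums of k weight vectors with weights in [lamhat - Q+], modulo [N]. The
    number of summands is recorded for the induction in [low_sum_separate]. *)
Inductive low_sum : nat -> V -> Prop :=
| low_sum0 v : N v -> low_sum 0 v
| low_sumS k mu d v : Qplus Sigma (lamhat - mu) -> weight_space T mu d ->
    low_sum k v -> low_sum k.+1 (d + v).

Lemma low_sum_shift k v t c : low_sum k v -> low_sum k (T t v - uscal gA c *: v).
Proof.
elim=> {k v} [v Nv|k mu d v Qmu dmu _ IH].
  apply: low_sum0; apply: submod_genD; first exact: raised_stable.
  by apply/submod_genN/submod_genZ.
rewrite cartan_actD scalerDr opprD addrACA; apply: low_sumS Qmu _ IH.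
by rewrite dmu -scalerBl -uscalB; apply: weight_scale.
Qed.

(** Weight vectors of distinct weights are independent modulo the stable
    submodule [N]: applying [T t - nu t] removes the summand of weight [nu] and
    multiplies [v] by [mu t - nu t]. *)
Lemma low_sum_separate k v mu : low_sum k v -> weight_space T mu v ->
  ~ Qplus Sigma (lamhat - mu) -> N v.
Proof.
elim: k v => [|k IH] v; first by move=> lv; inversion lv.
move=> lv; inversion lv as [|k' nu d v' Qnu dnu lv' kE vE]; subst.
move=> vmu Nmu; have [t mut] : exists t, mu t != nu t.
  apply: contrapT => mu_nu; apply: Nmu; suff -> : mu = nu by [].
  apply/lfunP => t; apply/eqP/negPn/negP => mut; apply: mu_nu; by exists t.
have Tv' : T t v' = uscal gA (mu t) *: (d + v') - uscal gA (nu t) *: d.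
  by rewrite -vmu cartan_actD dnu addrC addKr.
have Ev : uscal gA (mu t - nu t) *: (d + v') = T t v' - uscal gA (nu t) *: v'.
  by rewrite Tv' -addrA -opprD -scalerDr -scalerBl uscalB.
have c0 : mu t - nu t != 0 by rewrite subr_eq0.
have -> : d + v' = uscal gA (mu t - nu t)^-1 *: (uscal gA (mu t - nu t) *: (d + v')).
  by rewrite scalerA -uscalM mulVf // -[uscal gA 1]/(1 : Uenv gA) scale1r.
apply: submod_genZ; apply: IH; last exact: Nmu.
  by rewrite Ev; apply: low_sum_shift.
exact: weight_scale.
Qed.

Lemma low_sumD k l v w : low_sum k v -> low_sum l w -> low_sum (k + l) (v + w).
Proof.
move=> lv lw; elim: lv => {k v} [v Nv|k mu d v Qmu dmu _ IH]; last first.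
  by rewrite -addrA addSn; apply: low_sumS Qmu dmu IH.
elim: lw => {l w} [w Nw|l mu d w Qmu dmu _ IH].
  exact/low_sum0/submod_genD.
by rewrite addrCA; apply: low_sumS Qmu dmu IH.
Qed.

Lemma low_sumZ k c v : low_sum k v -> low_sum k (uscal gA c *: v).
Proof.
elim=> {k v} [v Nv|k mu d v Qmu dmu _ IH]; first exact/low_sum0/submod_genZ.
by rewrite scalerDr; apply: low_sumS Qmu _ IH; apply: weight_scale.
Qed.

Lemma low_sum_lower k y c v : lower y -> low_sum k v ->
  low_sum k (ugen gA (ten y c) *: v).
Proof.
move=> [a Qa [p ay]]; elim=> {k v} [v Nv|k mu d v Qmu dmu _ IH].
  exact/low_sum0/submod_genZ.
rewrite scalerDr; apply: low_sumS IH; last exact: weight_act ay dmu.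
by rewrite opprD addrA; apply: QplusD.
Qed.

(** The vectors obtained from [v0] by the action of the opposite Borel subalgebra
    with coefficients in [A], modulo [N]. That they exhaust [V] is the part of
    the Poincare-Birkhoff-Witt theorem that is needed here. *)
Inductive lower_span : V -> Prop :=
| lower_span_gen : lower_span v0
| lower_span_raised v : N v -> lower_span v
| lower_span_add v w : lower_span v -> lower_span w -> lower_span (v + w)
| lower_span_scale c v : lower_span v -> lower_span (uscal gA c *: v)
| lower_span_act y c v : lower y -> lower_span v ->
    lower_span (ugen gA (ten y c) *: v).

Lemma lower_span_low_sum v : lower_span v -> exists k, low_sum k v.
Proof.
elim=> {v} [|v Nv|v w _ [k lv] _ [l lw]|c v _ [k lv]|y c v ly _ [k lv]].
- exists 1; rewrite -[v0]addr0; apply: low_sumS v0_weight _.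
    by rewrite subrr; apply: Qplus0.
  exact/low_sum0/submod_gen0.
- by exists 0; apply: low_sum0.
- by exists (k + l); apply: low_sumD.
- by exists k; apply: low_sumZ.
- by exists k; apply: low_sum_lower.
Qed.

Lemma lower_span_current v :
  (forall y c, bracket_word S (@raising F G) y ->
    lower_span (ugen gA (ten y c) *: v)) ->
  lower_span v -> forall y c, lower_span (ugen gA (ten y c) *: v).
Proof.
move=> raise_v Lv y c; elim: (tri_decomp triG y) => [|d z w zP _ IH].
  by rewrite ten0l ugen0 scale0r; apply/lower_span_raised/submod_gen0.
rewrite tenPl ugenP scalerDl -scalerA; apply: lower_span_add => //.
apply: lower_span_scale; case: zP => [lz|Wz]; first exact: lower_span_act.
exact: raise_v.
Qed.

Lemma g_root_space_par p (a : hatd) y : g_root_space p a y -> par S p y.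
Proof. by move=> [x [dx [px _] <-]]; apply: tri_par. Qed.

(** A raising element moves to the right past a lower one at the cost of their
    bracket, which is again the sum of a lower and a raising element, and acts
    on a shorter product; arriving at [v0], the raising element falls in [N]. *)
Lemma lower_span_raise v : lower_span v -> forall y c,
  bracket_word S (@raising F G) y -> lower_span (ugen gA (ten y c) *: v).
Proof.
elim=> {v} [|v Nv|v w _ IHv _ IHw|d v _ IH|z d v lz Lv IH] y c Wy.
- by apply/lower_span_raised/raised_ten/nplus_words/submod_gen_mem.
- exact/lower_span_raised/submod_genZ.
- by rewrite scalerDr; apply: lower_span_add; [apply: IHv|apply: IHw].
- by rewrite scalerA -uscalC -scalerA; apply/lower_span_scale/IH.
have [_ _ [p /g_root_space_par py]] := raising_word_root Wy.
have [_ _ [q /g_root_space_par qz]] := lz.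
have := ugen_brk (ten_par1 c py : par gA p _) (ten_par1 d qz : par gA q _).
rewrite [brk gA _ _]ten_brkE => /esym/(canRL (subrK _)) E.
rewrite scalerA E scalerDl; apply: lower_span_add.
  exact: lower_span_current.
by rewrite -!scalerA; apply/lower_span_scale/lower_span_act => //; apply: IH.
Qed.

Lemma lower_span_full v : lower_span v.
Proof.
have [r ->] := v0_gen v.
suff H w : lower_span w -> lower_span (r *: w) by exact/H/lower_span_gen.
elim/uclP: r w => a; elim: a => [x|c|a IHa b IHb|a IHa b IHb] w Lw.
- rewrite -[ucl gA _]/(ugen gA x); elim/gten_ind: x => [|y c u IH].
    by rewrite ugen0 scale0r; apply/lower_span_raised/submod_gen0.
  rewrite ugenD scalerDl; apply: lower_span_add => //.
  by apply: lower_span_current => //; apply: lower_span_raise.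
- exact: lower_span_scale.
- by rewrite uclD scalerDl; apply: lower_span_add; [apply: IHa|apply: IHb].
- by rewrite uclM -scalerA; apply/IHa/IHb.
Qed.

Lemma outside_raised v : outside T lamhat v -> N v.
Proof.
move=> [mu [Nmu vmu]]; have [k lv] := lower_span_low_sum (lower_span_full v).
exact: low_sum_separate lv vmu Nmu.
Qed.

End WeightArgument.

(** * Universal properties *)

Section Lifts.

Section Quotient.
Variables (R : pzRingType) (M V : lmodType R) (X : M -> Prop).
Variable f : {linear M -> V}.

(** The proof that [f] kills [X] is an argument so that the linear structure of
    the lift can be inferred. *)
Definition qlift of forall x, X x -> f x = 0 := fun u : qmod X => f (qrep u).

Hypothesis fX : forall x, X x -> f x = 0.

Lemma qliftE x : qlift fX (qcl X x) = f x.
Proof.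
apply/eqP; rewrite -subr_eq0 /qlift -linearB; apply/eqP.
elim: (qrep_cl X x) => [|r y z Xy _ IH]; first exact: linear0.
by rewrite linearP (fX Xy) scaler0 add0r.
Qed.

Fact qlift_is_linear : linear (qlift fX).
Proof.
move=> r; elim/qclP=> x; elim/qclP=> y.
by rewrite -linearP !qliftE linearP.
Qed.

HB.instance Definition _ :=
  GRing.isLinear.Build R (qmod X) V *:%R (qlift fX) qlift_is_linear.

End Quotient.

Lemma scale_qcl1 (U : pzRingType) (rel : U -> Prop) (r : U) :
  r *: (@qcl U U^o rel 1 : qmod _) = @qcl U U^o rel r.
Proof. by rewrite -linearZ /= -[in RHS](mulr1 r). Qed.

Definition orbit_map (U : pzRingType) (W : lmodType U) (w : W) (r : U^o) : W :=
  (r : U) *: w.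

Fact orbit_map_is_linear (U : pzRingType) (W : lmodType U) (w : W) :
  linear (orbit_map w).
Proof. by move=> r x y; rewrite /orbit_map scalerDl -scalerA. Qed.

HB.instance Definition _ (U : pzRingType) (W : lmodType U) (w : W) :=
  GRing.isLinear.Build U U^o W *:%R (orbit_map w) (orbit_map_is_linear w).

(** A cyclic module that satisfies the relations is presented by them as soon as
    it maps back to the module that they define, generator to generator: the
    two maps are then inverse to each other. *)
Lemma presentation_retract (U : pzRingType) (W : lmodType U) (w : W)
    (rel : U -> Prop) (psi : {linear W -> @qmod U U^o rel}) :
  (forall r, rel r -> r *: w = 0) -> (forall v, exists r, v = r *: w) ->
  psi w = @qcl U U^o rel 1 -> has_presentation w rel.
Proof.
move=> rel_w w_gen psi_w.
have rel0 (r : U^o) : rel r -> orbit_map w r = 0 by exact: rel_w.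
pose phi : {linear @qmod U U^o rel -> W} := @qlift U U^o W rel (orbit_map w) rel0.
have phiE (r : U) : phi (@qcl U U^o rel r) = r *: w by exact: qliftE.
exists phi; split; last by rewrite phiE scale1r.
exists psi => [u|v].
  by elim/qclP: u => r; rewrite phiE linearZ /= psi_w scale_qcl1.
have [r ->] := w_gen v.
have -> : psi (r *: w) = @qcl U U^o rel r by rewrite linearZ /= psi_w scale_qcl1.
exact: phiE.
Qed.

Section ExtScalLift.
Variables (S R : pzRingType) (f : S -> R) (V : lmodType S) (M : lmodType R).

Fixpoint tlift_term (psi : V -> M) (a : tterm R V) : M :=
  match a with
  | TPure r v => r *: psi v
  | TZero => 0
  | TOpp b => - tlift_term psi b
  | TAdd b c => tlift_term psi b + tlift_term psi c
  end.

Definition balanced (psi : V -> M) :=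
  {morph psi : v w / v + w} /\ forall s v, psi (s *: v) = f s *: psi v.

(** The proof that [psi] is balanced is an argument so that the linear
    structure of the lift can be inferred. *)
Definition tlift psi of balanced psi :=
  fun u : ext_scal f V => tlift_term psi (trep u).

Variable psi : V -> M.
Hypothesis psiP : balanced psi.

Lemma tlift_term_teq a b : teq f a b -> tlift_term psi a = tlift_term psi b.
Proof.
have [psiD psiZ] := psiP; elim=> {a b} //=.
- by move=> a b c _ -> _.
- by move=> a b _ ->.
- by move=> a a' b b' _ -> _ ->.
- by move=> a b c; rewrite addrA.
- by move=> a b; rewrite addrC.
- by move=> a; rewrite add0r.
- by move=> a; rewrite addNr.
- by move=> r r' v; rewrite scalerDl.
- by move=> r v v'; rewrite psiD scalerDr.
- by move=> r s v; rewrite psiZ scalerA.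
Qed.

Lemma tliftE a : tlift psiP (tcl f a) = tlift_term psi a.
Proof. exact/tlift_term_teq/trep_cl. Qed.

Fact tlift_is_linear : linear (tlift psiP).
Proof.
move=> r; elim/tclP=> x; elim/tclP=> y.
have -> : r *: tcl f x = tcl f (tmul r x).
  apply/tcl_eq/tmul_teq; exact: trep_cl.
rewrite -tclD !tliftE /=; congr (_ + _).
by elim: x => /= [s v||x ->|x -> z ->]; rewrite ?scalerA ?scaler0 ?scalerN ?scalerDr.
Qed.

HB.instance Definition _ :=
  GRing.isLinear.Build R (ext_scal f V) M *:%R (tlift psiP) tlift_is_linear.

End ExtScalLift.

Lemma ext_scal_cyclic (S R : pzRingType) (f : S -> R) (V : lmodType S) (v : V) :
  (forall x, exists s, x = s *: v) ->
  forall u : ext_scal f V, exists r, u = r *: pure f 1 v.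
Proof.
move=> v_gen; elim/tclP; elim=> [r x||a [r ra]|a [r ra] b [s sb]].
- have [s ->] := v_gen x; exists (r * f s).
  by rewrite pureZ mulr1 pure_bal.
- by exists 0; rewrite scale0r.
- by exists (- r); rewrite tclN ra scaleNr.
- by exists (r + s); rewrite tclD ra sb scalerDl.
Qed.

End Lifts.

(** * The presentation of the global Weyl module *)

Lemma qcl_gen0 (R : pzRingType) (M : lmodType R) (X : M -> Prop) x :
  submod_gen X x -> qcl X x = 0.
Proof. by move=> Xx; rewrite -(linear0 (qcl X)); apply/qcl_eq; rewrite subr0. Qed.

Section Presentation.
Variables (F : fieldType) (G : root_datum F) (A : comAlgType F).
Variables (lam : hdual (rd_h G)) (Ye He : hdual (rd_cartan G) -> rd_g G).
Local Notation S := (rd_S G).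
Local Notation gA := (current S A).
Local Notation U := (Uenv gA).

Definition Vbar_rel : Uenv S -> Prop := hw_relation id (@nplus F G) lam Ye He.
Definition Weyl_rel : U -> Prop :=
  hw_relation (SL := gA) (fun x => ten x 1) (sub_ten (@nplus F G)) lam Ye He.
Local Notation M := (@qmod U U^o Weyl_rel).
Local Notation one := (@qcl U U^o Weyl_rel 1).

Lemma Uincl_rel r : Vbar_rel r -> Weyl_rel (Uincl A r).
Proof.
have UinclG x : Uincl A (ugen S x) = ugen gA (ten x 1) by exact: Uincl_cl.
have UinclS c : Uincl A (uscal S c) = uscal gA c by exact: Uincl_cl.
case=> [x nx|t|a k sa lamk].
- rewrite UinclG; apply: hw_relation_nil; rewrite -[ten x 1]addr0.
  by apply: sub_ten_cons => //; apply: sub_ten0.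
- rewrite rmorphB /= UinclG UinclS; exact: hw_relation_cartan.
- rewrite rmorphXn /= UinclG; exact: hw_relation_int lamk.
Qed.

Lemma Uincl_submod r : @submod_gen _ (Uenv S)^o Vbar_rel r ->
  @submod_gen _ U^o Weyl_rel (Uincl A r).
Proof.
elim=> [|s x y rx _ IH]; first by rewrite rmorph0; apply: submod_gen0.
rewrite rmorphD rmorphM.
by apply: (@submod_gen_cons U U^o Weyl_rel) => //; apply: Uincl_rel.
Qed.

(** Well defined since U(g) -> U(g (x) A) sends the relations of the generalized
    Kac module to relations of the module [M]. *)
Definition Vbar_map (v : Vbar lam Ye He) : M :=
  @qcl U U^o Weyl_rel (Uincl A (qrep v)).

Lemma Vbar_mapE r :
  Vbar_map (@qcl _ (Uenv S)^o Vbar_rel r) = @qcl U U^o Weyl_rel (Uincl A r).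
Proof.
apply/qcl_eq; rewrite -rmorphB; apply: Uincl_submod.
exact: (@qrep_cl _ (Uenv S)^o Vbar_rel r).
Qed.

Lemma Vbar_map_balanced : balanced (@Uincl F _ S A) Vbar_map.
Proof.
split=> [|s]; elim/qclP=> x; last first.
  have -> : s *: (qcl _ x : Vbar lam Ye He) = @qcl _ (Uenv S)^o Vbar_rel (s * x).
    by rewrite -linearZ.
  by rewrite !Vbar_mapE rmorphM -[LHS]scale_qcl1 -scalerA scale_qcl1.
elim/qclP=> y.
have -> : (qcl _ x : Vbar lam Ye He) + qcl _ y = @qcl _ (Uenv S)^o Vbar_rel (x + y).
  by rewrite -linearD.
by rewrite !Vbar_mapE rmorphD -linearD.
Qed.

Definition P_A_map : {linear P_A A (Vbar lam Ye He) -> M} :=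
  tlift Vbar_map_balanced.

Lemma P_A_map_vlam : P_A_map (vlam A lam Ye He) = one.
Proof.
rewrite /P_A_map /= /vlam /pure tliftE /= scale1r [LHS]Vbar_mapE.
by rewrite rmorph1.
Qed.

Lemma vlam_gen u : exists r, u = r *: vlam A lam Ye He.
Proof.
apply: ext_scal_cyclic; elim/qclP=> x; exists x.
by rewrite [RHS]scale_qcl1.
Qed.

Lemma vlam_rel r : Vbar_rel r -> Uincl A r *: vlam A lam Ye He = 0.
Proof.
move=> rr; rewrite /vlam pureZ mulr1 -[Uincl A r]mul1r pure_bal.
have -> : r *: vbar lam Ye He = 0.
  by rewrite [LHS]scale_qcl1; apply: qcl_gen0; apply: submod_gen_mem.
by apply: (addrI (pure _ 1 0)); rewrite -pureDr !addr0.
Qed.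

End Presentation.

Theorem proposition3p4 (R : realType) (G : root_datum R[i]) (A : comAlgType R[i])
    (Xe Ye He : hdual (rd_cartan G) -> rd_g G)
    (lam : hdual (rd_h G)) (lamhat : hdual (rd_cartan G))
    (T : subvs_of (rd_cartan G) -> P_A A (Vbar lam Ye He) -> P_A A (Vbar lam Ye He)) :
  admissible G ->
  sl2_triples Xe Ye He ->
  Lambda_plus lam ->
  (forall t : subvs_of (rd_cartan G), rd_dom (vsval t) ->
     lamhat t = lam (vsproj (rd_h G) (rd_pi G (vsval t)))) ->
  cartan_action T ->
  weight_space T lamhat (vlam A lam Ye He) ->
  let W := weight_quotient T lamhat in
  let w : W := qcl (outside T lamhat) (vlam A lam Ye He) in
  has_presentation w
    (hw_relation (SL := current (rd_S G) A) (fun x => ten x 1)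
       (sub_ten (@nplus _ G)) lam Ye He).
Proof.
move=> admG _ _ _ T_action vlam_weight W w.
have char0 : [pchar R[i]] =i pred0 by exact: Num.Theory.pchar_num.
have triG := admissible_triangular char0 admG.
have map0 v : outside T lamhat v -> P_A_map A lam Ye He v = 0.
  move/(outside_raised triG char0 T_action vlam_weight (@vlam_gen _ G A lam Ye He)).
  elim=> [|r y z [x nx ->] _ IH]; first exact: linear0.
  rewrite linearP IH addr0 linearZ /= [tlift _ _]P_A_map_vlam.
  rewrite scale_qcl1 qcl_gen0 ?scaler0 //; apply: submod_gen_mem.
  exact: hw_relation_nil.
pose psi : {linear W -> _} := qlift map0.
apply: (presentation_retract (psi := psi)) => [r|v|].
- case=> [x nx|t|a k sa lamk]; rewrite /w -linearZ /=.
  + apply: qcl_gen0; apply: (raised_outside triG char0 T_action vlam_weight).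
    by exists x.
  + have <- : Uincl A (ugen (rd_S G) (vsval t) - uscal (rd_S G) (lam t)) =
        ugen (current (rd_S G) A) (ten (vsval t) 1) - uscal _ (lam t).
      by rewrite rmorphB; congr (_ - _); apply: Uincl_cl.
    by rewrite vlam_rel ?linear0 //; apply: hw_relation_cartan.
  + have <- : Uincl A (ugen (rd_S G) (Ye a) ^+ k.+1) =
        ugen (current (rd_S G) A) (ten (Ye a) 1) ^+ k.+1.
      by rewrite rmorphXn; congr (_ ^+ _); apply: Uincl_cl.
    by rewrite vlam_rel ?linear0 //; apply: hw_relation_int lamk.
- elim/qclP: v => v; have [r ->] := vlam_gen v; exists r.
  by rewrite /w -linearZ.
- have -> : psi w = P_A_map A lam Ye He (vlam A lam Ye He) by exact: qliftE.
  exact: P_A_map_vlam.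
Qed.
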